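(* Let $E$ be a row-finite directed graph. The $C^*$-algebra $C^*_{\min}(E)$ is the universal $C^*$-algebra generated by a normalised reduced Cuntz-Krieger $E$-family. That is, if $\{q_v : v \in E^0\}$, $\{t_e : e \in E^1\}$ is another normalised reduced Cuntz-Krieger $E$-family in a $C^*$-algebra $B$, then there is a homomorphism $\pi_{q,t} : C^*_{\min}(E) \to B$ such that $\pi_{q,t}(p^m_v) = q_v$ for all $v \in E^0$ and $\pi_{q,t}(s^m_e) = t_e$ for all $e \in E^1$.
   Context: A directed graph $E$ consists of countable sets $E^0$ (vertices) and $E^1$ (edges) and maps $r,s : E^1 \to E^0$; the edge $e$ points from $s(e)$ to $r(e)$. Write $vE^1 = r^{-1}(v)$. $E$ is row-finite if $vE^1$ is finite for every $v \in E^0$. A path is a sequence $\lambda = \lambda_1 \cdots \lambda_n$ of edges with $s(\lambda_i) = r(\lambda_{i+1})$ for $i<n$; $r(\lambda) = r(\lambda_1)$, $s(\lambda) = s(\lambda_n)$, $|\lambda| = n$ (vertices are paths of length $0$). For elements $t_e$ indexed by edges, $t_\lambda := t_{\lambda_1}\cdots t_{\lambda_n}$. A cycle is a path $\mu = \mu_1 \cdots \mu_{|\mu|}$ with $|\mu| \ge 1$, $r(\mu) = s(\mu)$ and $s(\mu_i) \ne s(\mu_j)$ for $i<j$. It has no entrance in $E$ if $e \in E^1$ and $r(e) = r(\mu_i)$ imply $e = \mu_i$, for all $i$. For a cycle $\mu$, $[\mu]$ is the set of its cyclic permutations and $[\mu]^1 = \{\mu_i : 1 \le i \le |\mu|\}$.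 $C(E)$ is the set of all $[\mu]$ where $\mu$ is a cycle with no entrance in $E$, and $C(E)^1 = \bigcup_{C \in C(E)} C^1$. A cutting set for $E$ is a subset $X \subset C(E)^1$ such that $X \cap C^1$ is a singleton for each $C \in C(E)$. A Toeplitz-Cuntz-Krieger $E$-family in a $C^*$-algebra consists of elements $\{p_v : v \in E^0\}$, $\{s_e : e \in E^1\}$ such that (T1) the $p_v$ are mutually orthogonal projections; (T2) $s_e^* s_e = p_{s(e)}$ for all $e \in E^1$; (T3) $p_v \ge \sum_{e \in F} s_e s_e^*$ for all $v \in E^0$ and finite $F \subset r^{-1}(v)$. It is a Cuntz-Krieger $E$-family if moreover (CK) $p_v = \sum_{r(e)=v} s_e s_e^*$ whenever $0 < |r^{-1}(v)| < \infty$. A normalised reduced Cuntz-Krieger $E$-family is a Cuntz-Krieger $E$-family such that $s_\mu = p_{r(\mu)}$ for each cycle $\mu$ with no entrance in $E$. $C^*_{\min}(E)$ denotes the co-universal $C^*$-algebra of $E$ (existing for row-finite $E$, and unique up to isomorphism): it is generated by a normalised reduced Cuntz-Krieger $E$-family $\{p^m_v : v \in E^0\}$, $\{s^m_e : e \in E^1\}$ such that (a) every $p^m_v$ is nonzero; (b) given any Toeplitz-Cuntz-Krieger $E$-family $\{q_v\}, \{t_e\}$ in a $C^*$-algebra with each $q_v \ne 0$ and any cutting set $X$ for $E$, there are a function $\kappa : X \to \mathbb{T}$ and a homomorphism $\psi_{q,t} : C^*(\{q_v, t_e : v \in E^0, e \in E^1\}) \to C^*_{\min}(E)$ with $\psi_{q,t}(q_v)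 = p^m_v$ for all $v \in E^0$, $\psi_{q,t}(t_e) = s^m_e$ for all $e \in E^1 \setminus X$, and $\psi_{q,t}(t_x) = \kappa(x) s^m_x$ for all $x \in X$. *)

(* Defs.v *)
From HB Require Import structures.
From mathcomp Require Import all_boot all_order all_algebra.
From mathcomp Require Import complex.
From mathcomp Require Import all_classical all_reals all_analysis.

Set Implicit Arguments.
Unset Strict Implicit.
Unset Printing Implicit Defensive.

Import Order.TTheory GRing.Theory Num.Theory.
Import numFieldNormedType.Exports.

Local Open Scope classical_set_scope.
Local Open Scope ring_scope.
Local Open Scope complex_scope.

(* C*-algebras are not assumed unital, so the multiplication cannot come from
   the ring hierarchy and is added on top of a Banach space over R[i].
   The norm of such a space takes its (real) values in R[i]. *)
HB.mixin Record isCStarAlgebra (R : realType) A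
    of CompleteNormedModule R[i] A := {
  cmul : A -> A -> A ;
  adj : A -> A ;
  cmulA : associative cmul ;
  cmulDl : left_distributive cmul +%R ;
  cmulDr : right_distributive cmul +%R ;
  cmulZl : forall (a : R[i]) (x y : A), cmul (a *: x) y = a *: cmul x y ;
  cmulZr : forall (a : R[i]) (x y : A), cmul x (a *: y) = a *: cmul x y ;
  adjK : involutive adj ;
  adjD : {morph adj : x y / x + y} ;
  adjZ : forall (a : R[i]) (x : A), adj (a *: x) = a^* *: adj x ;
  adjM : forall x y : A, adj (cmul x y) = cmul (adj y) (adj x) ;
  norm_cmul_le : forall x y : A, `|cmul x y| <= `|x| * `|y| ;
  cstar_identity : forall x : A, `|cmul (adj x) x| = `|x| ^+ 2 }.

#[short(type="cstarAlgType")]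
HB.structure Definition CStarAlgebra (R : realType) :=
  {A of isCStarAlgebra R A & CompleteNormedModule R[i] A}.

Notation "x ** y" := (cmul x y) (at level 40, left associativity).

Section CStarTheory.
Context {R : realType}.
Implicit Types A B : cstarAlgType R.

Definition positive A (x : A) : Prop := exists y : A, x = adj y ** y.

Definition cle A (x y : A) : Prop := positive (y - x).

Definition projection A (p : A) : Prop := adj p = p /\ p ** p = p.

Definition cstar_subalgebra A (D : set A) : Prop :=
  [/\ D 0,
      (forall (a : R[i]) x y, D x -> D y -> D (a *: x + y)),
      (forall x y, D x -> D y -> D (x ** y)),
      (forall x, D x -> D (adj x))
    & closed D].

Definition cstar_gen A (S : set A) : set A := smallest (@cstar_subalgebra A) S.

(* A *-homomorphism defined on a *-subalgebra [D] of [A] is represented by a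
   total function whose values outside [D] are irrelevant. *)
Definition star_hom_on A B (D : set A) (f : A -> B) : Prop :=
  [/\ (forall (a : R[i]) x y, D x -> D y -> f (a *: x + y) = a *: f x + f y),
      (forall x y, D x -> D y -> f (x ** y) = f x ** f y)
    & (forall x, D x -> f (adj x) = adj (f x))].

Definition star_hom A B (f : A -> B) : Prop := star_hom_on setT f.

End CStarTheory.

Record digraph := Digraph {
  vertex : countType ;
  edge : countType ;
  rng : edge -> vertex ;
  src : edge -> vertex }.

Section Graphs.
Variable E : digraph.
Implicit Types (v : vertex E) (e f : edge E) (mu : seq (edge E)).

Definition edges_into v : set (edge E) := [set e | rng e = v].

Definition row_finite : Prop := forall v, finite_set (edges_into v).

(* Edges point from source to range, and paths are composed right to left as
   maps are: [mu_1; ...; mu_n] is a path when s(mu_i) = r(mu_(i+1)). *)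
Definition is_path mu : bool := sorted (fun e f => src e == rng f) mu.

Definition is_cycle mu : Prop :=
  if mu is e :: mu' then
    [/\ is_path mu, rng e = src (last e mu') & uniq (map (@src E) mu)]
  else False.

Definition no_entrance mu : Prop :=
  forall e f, f \in mu -> rng e = rng f -> e = f.

Definition cyclic_class mu : set (seq (edge E)) := [set rot n mu | n in setT].

Definition cycles_no_entrance : set (set (seq (edge E))) :=
  [set cyclic_class mu | mu in [set mu | is_cycle mu /\ no_entrance mu]].

Definition class_edges (C : set (seq (edge E))) : set (edge E) :=
  [set e | exists2 mu, C mu & e \in mu].

Definition cutting_set (X : set (edge E)) : Prop :=
  X `<=` \bigcup_(C in cycles_no_entrance) class_edges C /\
  forall C, cycles_no_entrance C -> exists x, X `&` class_edges C = [set x].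

End Graphs.

Section Families.
Context {R : realType} (E : digraph).

Section OneAlgebra.
Variables (A : cstarAlgType R) (p : vertex E -> A) (s : edge E -> A).

(* The product along the nonempty path [e :: mu]. *)
Definition path_prod (e : edge E) (mu : seq (edge E)) : A :=
  foldl (fun x f => x ** s f) (s e) mu.

Definition toeplitz_CK_family : Prop :=
  [/\ (forall v, projection (p v)),
      (forall v w, v <> w -> p v ** p w = 0),
      (forall e, adj (s e) ** s e = p (src e))
    & (forall v (F : set (edge E)), finite_set F -> F `<=` edges_into v ->
        cle (\sum_(e \in F) (s e ** adj (s e))) (p v))].

Definition CK_family : Prop :=
  toeplitz_CK_family /\
  forall v, edges_into v !=set0 -> finite_set (edges_into v) ->
    p v = \sum_(e \in edges_into v) (s e ** adj (s e)).

Definition normalised_reduced_CK_family : Prop :=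
  CK_family /\
  forall e mu, is_cycle (e :: mu) -> no_entrance (e :: mu) ->
    path_prod e mu = p (rng e).

Definition family_algebra : set A := cstar_gen (range p `|` range s).

End OneAlgebra.

(* [A], with the family [p], [s], is the co-universal algebra C*_min(E). *)
Definition is_cstar_min (A : cstarAlgType R)
    (p : vertex E -> A) (s : edge E -> A) : Prop :=
  [/\ normalised_reduced_CK_family p s,
      family_algebra p s = setT,
      (forall v, p v <> 0)
    & (forall (B : cstarAlgType R) (q : vertex E -> B) (t : edge E -> B),
        toeplitz_CK_family q t -> (forall v, q v <> 0) ->
        forall X : set (edge E), cutting_set X ->
        exists (kappa : edge E -> R[i]) (psi : B -> A),
          [/\ (forall x, X x -> `|kappa x| = 1),
              star_hom_on (family_algebra q t) psi,
              (forall v, psi (q v) = p v),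
              (forall e, ~ X e -> psi (t e) = s e)
            & (forall x, X x -> psi (t x) = kappa x *: s x)])].

End Families.

(* Main.v *)
Require Import Defs.
From mathcomp Require Import all_boot all_order all_algebra.
From mathcomp Require Import cyclic separable cyclotomic.
From mathcomp Require Import complex.
From mathcomp Require Import all_classical all_reals all_analysis.
From mathcomp Require Import ring lra zify.

Set Implicit Arguments.
Unset Strict Implicit.
Unset Printing Implicit Defensive.

Import Order.TTheory GRing.Theory Num.Theory.
Import numFieldNormedType.Exports.

Local Open Scope classical_set_scope.
Local Open Scope ring_scope.
Local Open Scope complex_scope.

(** The homomorphism must send a linear combination of products of generators
    to the same combination in [B]; it exists as soon as the norm in [B] of such
    a combination never exceeds its norm in the co-universal algebra, for then
    it is well defined and extends by continuity ([star_hom_extension]).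

    To prove this inequality, remove a cutting set [X] from the graph.  The
    normalisation expresses each removed edge through the other edges of its
    cycle ([cut_edge_elt]), so the remaining edges still generate, and they
    satisfy the Cuntz-Krieger relations of the smaller graph
    ([CK_family_relations]).  For the smaller graph no relation between cycles
    and vertices is left, and co-universality, applied to the canonical family
    rotated by a complex number of modulus 1, provides a gauge action on the
    algebra generated by it ([couniversal_gauge]).  The statement becomes a
    gauge-invariant uniqueness theorem ([nrm_span_le]).

    The usual proof of the latter uses approximately finite-dimensional algebras
    and faithful conditional expectations.  Here it is obtained by elementary
    estimates sharpened by taking powers: by the C*-identity, a bound
    [nrm b <= K nrm a] which holds for all [(a^* a)^n], [(b^* b)^n] with [K]
    growing subexponentially in [n] implies [nrm b <= nrm a]
    ([nrm_le_of_linear_growth]).  This is done twice.  Elements of degree zero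
    expand into finitely many matrix units, whose coefficients are bounded by
    the norm because the vertex projections are nonzero ([nrm_balanced_le]).
    A general element of degree at most [N] is the sum of its [2 N + 1]
    homogeneous components; averaging over the gauge action bounds these in the
    first algebra ([homogeneous_components]), and for a homogeneous component
    [b] the product [b^* b] has degree zero ([nrm_component_le]).

    Two facts about C*-algebras are needed on the way, the contractivity of
    star-homomorphisms ([star_hom_contractive]), for the gauge action, and the
    mutual orthogonality of projections whose sum is a projection
    ([projection_sum]), for the relations between edges.  Both follow from the
    existence of square roots of [1 - h] for self-adjoint [h] of norm less than
    1 ([sqrt_one_minus]). *)

(** * C*-algebras with a real-valued norm *)
Section RealNorm.
Context {R : realType} {A : cstarAlgType R}.
Implicit Types (x y z : A) (a : R[i]).

(** The library norms take values in [R[i]]; taking real parts turns every norm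
    estimate into an inequality between elements of an archimedean real field. *)
Definition cnorm a : R := complex.Re `|a|.

Lemma cnormE a : `|a| = (cnorm a)%:C.
Proof. by rewrite /cnorm RRe_real ?normr_real. Qed.

Definition nrm x : R := complex.Re `|x|.

Lemma nrmE x : `|x| = (nrm x)%:C.
Proof. by rewrite /nrm RRe_real ?normr_real. Qed.

Lemma nrm_leE x (c : R) : (`|x| <= c%:C) = (nrm x <= c).
Proof. by rewrite nrmE lecR. Qed.

Lemma nrm_ge0 x : 0 <= nrm x.
Proof. by rewrite -lecR -nrmE normr_ge0. Qed.

Lemma nrm0 : nrm 0 = 0.
Proof. by rewrite /nrm normr0. Qed.

Lemma nrm0_eq0 x : nrm x = 0 -> x = 0.
Proof. by move=> x0; apply/normr0_eq0; rewrite nrmE x0. Qed.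

Lemma nrmD x y : nrm (x + y) <= nrm x + nrm y.
Proof. by rewrite -nrm_leE (le_trans (ler_normD _ _))// !nrmE -rmorphD. Qed.

Lemma nrmN x : nrm (- x) = nrm x.
Proof. by rewrite /nrm normrN. Qed.

Lemma nrmB x y : nrm (x - y) <= nrm x + nrm y.
Proof. by rewrite (le_trans (nrmD _ _))// nrmN. Qed.

Lemma nrm_distC x y : nrm (x - y) = nrm (y - x).
Proof. by rewrite -nrmN opprB. Qed.

Lemma nrmZ a x : nrm (a *: x) = cnorm a * nrm x.
Proof.
by apply/complexI; rewrite rmorphM /= -!nrmE -cnormE normrZ.
Qed.

Lemma nrmM x y : nrm (x ** y) <= nrm x * nrm y.
Proof. by rewrite -nrm_leE rmorphM /= -!nrmE norm_cmul_le. Qed.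

Lemma nrm_adjl x : nrm (adj x ** x) = nrm x ^+ 2.
Proof. by apply/complexI; rewrite rmorphXn /= -!nrmE cstar_identity. Qed.

Lemma cmul0l x : 0 ** x = 0.
Proof. by apply: (addrI (0 ** x)); rewrite -cmulDl !addr0. Qed.

Lemma cmul0r x : x ** 0 = 0.
Proof. by apply: (addrI (x ** 0)); rewrite -cmulDr !addr0. Qed.

Lemma cmulNl x y : - x ** y = - (x ** y).
Proof. by apply/eqP; rewrite -addr_eq0 -cmulDl addNr cmul0l. Qed.

Lemma cmulNr x y : x ** - y = - (x ** y).
Proof. by apply/eqP; rewrite -addr_eq0 -cmulDr addNr cmul0r. Qed.

Lemma cmulBl x y z : (x - y) ** z = x ** z - y ** z.
Proof. by rewrite cmulDl cmulNl. Qed.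

Lemma cmulBr x y z : z ** (x - y) = z ** x - z ** y.
Proof. by rewrite cmulDr cmulNr. Qed.

Lemma adj0 : adj (0 : A) = 0.
Proof. by apply: (addrI (adj 0)); rewrite -adjD !addr0. Qed.

Lemma adjN x : adj (- x) = - adj x.
Proof. by apply/eqP; rewrite -addr_eq0 -adjD addNr adj0. Qed.

Lemma adjB x y : adj (x - y) = adj x - adj y.
Proof. by rewrite adjD adjN. Qed.

Lemma adj_eq0 x : adj x ** x = 0 -> x = 0.
Proof.
move=> xx0; apply: nrm0_eq0; apply/eqP; rewrite -sqrf_eq0 -nrm_adjl xx0.
by rewrite nrm0.
Qed.

Lemma nrm_adj x : nrm (adj x) = nrm x.
Proof.
suff le y : nrm y <= nrm (adj y).
  by apply/eqP; rewrite eq_le le andbT -{2}(adjK x) le.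
have [->|y0] := eqVneq (nrm y) 0; first exact: nrm_ge0.
have ygt0 : 0 < nrm y by rewrite lt_def y0 nrm_ge0.
by rewrite -(ler_pM2r ygt0) -expr2 -nrm_adjl nrmM.
Qed.

Lemma cmul_suml I (s : seq I) (P : pred I) (F : I -> A) x :
  (\sum_(i <- s | P i) F i) ** x = \sum_(i <- s | P i) (F i ** x).
Proof.
by elim/big_rec2: _ => [|i y z _ <-]; rewrite ?cmul0l ?cmulDl.
Qed.

Lemma cmul_sumr I (s : seq I) (P : pred I) (F : I -> A) x :
  x ** (\sum_(i <- s | P i) F i) = \sum_(i <- s | P i) (x ** F i).
Proof.
by elim/big_rec2: _ => [|i y z _ <-]; rewrite ?cmul0r ?cmulDr.
Qed.

Lemma nrm_sum I (s : seq I) (P : pred I) (F : I -> A) :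
  nrm (\sum_(i <- s | P i) F i) <= \sum_(i <- s | P i) nrm (F i).
Proof.
elim/big_rec2: _ => [|i y z _ yz]; first by rewrite nrm0.
by rewrite (le_trans (nrmD _ _))// lerD2l.
Qed.

Lemma cnorm_real (c : R) : 0 <= c -> cnorm c%:C = c.
Proof. by move=> c0; rewrite /cnorm ger0_norm ?ler0c. Qed.

Lemma cnorm1 a : `|a| = 1 -> cnorm a = 1.
Proof. by rewrite /cnorm => ->. Qed.

Lemma nrm_bound_eq0 x : (forall e : R, 0 < e -> nrm x <= e) -> x = 0.
Proof.
move=> h; apply: nrm0_eq0; apply/eqP; rewrite eq_le nrm_ge0 andbT.
by apply/ler_addgt0Pl => e e0; rewrite addr0 h.
Qed.

(** Completeness in the form in which it is used below: an explicit Cauchy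
    modulus [d] survives in the limit as an explicit rate of convergence. *)
Lemma complete_nrm (u : nat -> A) (d : nat -> R) :
  (forall n m, (n <= m)%N -> nrm (u m - u n) <= d n) ->
  (forall e : R, 0 < e -> exists n, d n < e) ->
  exists l, forall n, nrm (u n - l) <= d n.
Proof.
move=> ud d0.
have cu : cvgn u.
  apply/cauchy_cvgP/cauchy_exP => e; rewrite ltcE => /andP[/eqP ime e0].
  have [n dn] := d0 _ e0; exists (u n), n => //= m /= nm.
  rewrite -ball_normE /= distrC nrmE ltcE ime eqxx /=.
  exact: le_lt_trans (ud _ _ nm) dn.
exists (limn u) => n; apply/ler_addgt0Pl => e e0.
move/cvgrPdist_lt : cu => /(_ e%:C); rewrite ltcR => /(_ e0) [m _ um].
have := um (maxn m n) (leq_maxl _ _); rewrite /= nrmE ltcR => lt.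
have := ud n (maxn m n) (leq_maxr _ _).
rewrite nrm_distC => le; rewrite -(subrKA (u (maxn m n))).
rewrite (le_trans (nrmD _ _))// addrC lerD// nrm_distC; exact: ltW.
Qed.

Lemma closed_nrm (D : set A) :
  (forall x, (forall e : R, 0 < e -> exists2 y, D y & nrm (x - y) < e) -> D x) ->
  closed D.
Proof.
move=> Dlim x clx; apply: Dlim => e e0.
have [|y [Dy]] := clx (ball x e%:C).
  by apply: nbhsx_ballx; rewrite ltcR.
by rewrite -ball_normE /= nrmE ltcR => xy; exists y.
Qed.

Lemma expr_to0 (r : R) : 0 <= r < 1 -> forall e : R, 0 < e -> exists n, r ^+ n < e.
Proof.
case/andP=> r0 r1 e e0.
have /cvgrPdist_lt/(_ e e0)[n _ /(_ n (leqnn _))] : (fun n => r ^+ n) @ \oo --> (0:R).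
  by apply: cvg_expr; rewrite ger0_norm.
by rewrite /= sub0r normrN ger0_norm ?exprn_ge0// => h; exists n.
Qed.

(** [1 - g] is the square root of [1 - h], expressed without a unit.  The map
    [T] below is a contraction of ratio [nrm h] on the ball of radius [nrm h],
    and [g] is its fixed point.  The iterates of [T] are polynomials in [h], so
    [g] inherits self-adjointness and commutes with whatever commutes with [h].
    This is the only fragment of functional calculus that is needed. *)
Lemma sqrt_one_minus h : adj h = h -> nrm h < 1 ->
  exists g, [/\ adj g = g, g ** g = 2%:R *: g - h
    & forall x, x ** h = h ** x -> x ** g = g ** x].
Proof.
move=> hh h1; set r := nrm h.
have r0 : 0 <= r by exact: nrm_ge0.
pose T g := 2%:R^-1 *: (h + g ** g).
pose u n := iter n T 0.
have half : cnorm (2%:R^-1) = 2%:R^-1.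
  have -> : (2%:R^-1 : R[i]) = (2%:R^-1)%:C by rewrite fmorphV rmorph_nat.
  by rewrite cnorm_real ?invr_ge0.
have two0 : (2%:R : R[i]) != 0 by rewrite pnatr_eq0.
have uS n : u n.+1 = 2%:R^-1 *: (h + u n ** u n) by [].
have ur n : nrm (u n) <= r.
  elim: n => [|n IH]; first by rewrite nrm0.
  rewrite uS nrmZ half.
  have := nrmD h (u n ** u n); have := nrmM (u n) (u n); have := nrm_ge0 (u n).
  rewrite -/r; nra.
have step n : nrm (u n.+1 - u n) <= r ^+ n * r.
  elim: n => [|n IH].
    rewrite uS cmul0r addr0 subr0 nrmZ half -/r; lra.
  rewrite uS [X in _ - X]uS -scalerBr nrmZ half.
  rewrite opprD addrACA subrr add0r.
  have -> : u n.+1 ** u n.+1 - u n ** u n =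
     u n.+1 ** (u n.+1 - u n) + (u n.+1 - u n) ** u n.
    by rewrite cmulBr cmulBl subrKA.
  have := nrmD (u n.+1 ** (u n.+1 - u n)) ((u n.+1 - u n) ** u n).
  have := nrmM (u n.+1) (u n.+1 - u n).
  have := nrmM (u n.+1 - u n) (u n).
  have := ur n; have := ur n.+1.
  have := nrm_ge0 (u n.+1 - u n).
  rewrite exprS; move: IH; set q := r ^+ n.
  set a := nrm (u n.+1 - u n); set b := nrm (u n.+1); set c := nrm (u n).
  set D1 := nrm _; set D2 := nrm _; set D3 := nrm _ => IH a0 br cr d2 d1 d3.
  have : b * a <= r * a by exact: ler_wpM2r.
  have : a * c <= a * r by exact: ler_wpM2l.
  have : r * a <= r * (q * r) by exact: ler_wpM2l.
  lra.
have r1 : 0 < 1 - r by rewrite subr_gt0.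
pose d n := r ^+ n / (1 - r).
have dist n k : nrm (u (n + k)%N - u n) <= (r ^+ n - r ^+ (n + k)) / (1 - r).
  elim: k => [|k IH]; first by rewrite addn0 !subrr nrm0 mul0r.
  rewrite -(subrKA (u (n + k)%N)) (le_trans (nrmD _ _))//.
  rewrite addnS (le_trans (lerD (step _) IH))// exprS.
  rewrite -(ler_pM2r r1) mulrDl !divfK ?gt_eqF//.
  have := mulr_ge0 (exprn_ge0 (n + k) r0) (sqr_ge0 (1 - r)).
  rewrite expr2; nra.
have d0 : forall e : R, 0 < e -> exists n, d n < e.
  move=> e e0; have [|n rn] := @expr_to0 r _ (e * (1 - r)) (mulr_gt0 e0 r1).
    by rewrite r0.
  by exists n; rewrite /d ltr_pdivrMr.
have [|g gu] := @complete_nrm u d _ d0.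
  move=> n m nm; rewrite -(subnKC nm) (le_trans (dist _ _))//.
  rewrite ler_pM2r ?invr_gt0// lerBlDr lerDl exprn_ge0//.
have lim0 x (C : R) : 0 <= C -> (forall n, nrm x <= C * d n) -> x = 0.
  move=> C0 xC; apply: nrm_bound_eq0 => e e0.
  have [|n dn] := d0 (e / (C + 1)); first by rewrite divr_gt0// ltr_wpDl.
  rewrite (le_trans (xC n))//.
  have C1 : 0 < C + 1 by rewrite ltr_wpDl.
  move: dn; rewrite ltr_pdivlMr// => dn.
  have : 0 <= d n by rewrite /d divr_ge0 ?exprn_ge0// ltW.
  nra.
have d_ge0 n : 0 <= d n by rewrite /d divr_ge0 ?exprn_ge0// ltW.
have dS n : d n.+1 <= d n.
  rewrite /d ler_pM2r ?invr_gt0// exprS.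
  have := exprn_ge0 n r0; nra.
exists g; split.
- apply/eqP; rewrite -subr_eq0; apply/eqP.
  have uu n : adj (u n) = u n.
    elim: n => [|n IH]; first by rewrite adj0.
    rewrite uS Defs.adjZ adjD hh adjM IH; congr (_ *: _).
    by rewrite fmorphV rmorph_nat.
  apply: (lim0 _ 2%:R) => // n.
  have -> : adj g - g = adj (g - u n) + (u n - g) by rewrite adjB uu subrKA.
  by rewrite (le_trans (nrmD _ _))// nrm_adj (nrm_distC g) mulr_natl mulr2n lerD ?gu.
- apply/eqP; rewrite -subr_eq0; apply/eqP.
  apply: (lim0 _ (nrm g + 3%:R)) => [|n]; first by rewrite addr_ge0 ?nrm_ge0.
  have -> : g ** g - (2%:R *: g - h) =
      (g ** (g - u n) + (g - u n) ** u n) + 2%:R *: (u n.+1 - g).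
    rewrite uS scalerBr scalerA divff// scale1r.
    rewrite cmulBr cmulBl subrKA opprB addrA.
    by rewrite -[RHS]addrA (addrA (- (u n ** u n))) (addrCA (- (u n ** u n)))
      addNr addr0 addrA.
  have := nrmD (g ** (g - u n) + (g - u n) ** u n) (2%:R *: (u n.+1 - g)).
  have := nrmD (g ** (g - u n)) ((g - u n) ** u n).
  have := nrmM g (g - u n).
  have := nrmM (g - u n) (u n).
  have -> : nrm (2%:R *: (u n.+1 - g)) = 2%:R * nrm (u n.+1 - g).
    by rewrite nrmZ -(rmorph_nat (real_complex R)) cnorm_real.
  have := gu n.+1; have := dS n; have := gu n; rewrite nrm_distC.
  have := d_ge0 n; have := nrm_ge0 (g - u n); have := ur n; have := nrm_ge0 g.
  set G := nrm g; set a := nrm (g - u n); set c := nrm (u n); set q := d n.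
  set b := nrm (u n.+1 - g); set qq := d n.+1.
  set D1 := nrm _; set D2 := nrm _; set D3 := nrm _; set D4 := nrm _.
  move=> G0 cr a0 q0 aq qq' bq h1' h2 h3 h4.
  have : G * a <= G * q by exact: ler_wpM2l.
  have : a * c <= a * 1 by apply: ler_wpM2l => //; lra.
  lra.
- move=> x xh.
  have xu n : x ** u n = u n ** x.
    elim: n => [|n IH]; first by rewrite cmul0l cmul0r.
    rewrite uS cmulZl cmulZr cmulDl cmulDr xh.
    by rewrite cmulA IH -cmulA IH cmulA.
  apply/eqP; rewrite -subr_eq0; apply/eqP.
  apply: (lim0 _ (2%:R * nrm x)) => [|n]; first by rewrite mulr_ge0 ?nrm_ge0.
  have -> : x ** g - g ** x = x ** (g - u n) + (u n - g) ** x.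
    by rewrite cmulBr cmulBl xu subrKA.
  rewrite (le_trans (nrmD _ _))//.
  have := nrmM x (g - u n); have := nrmM (u n - g) x; have := gu n.
  have := nrm_ge0 x; rewrite (nrm_distC g); nra.
Qed.

End RealNorm.

(** * Star-homomorphisms are contractive *)
Section Contractive.
Context {R : realType}.
Implicit Types A B : cstarAlgType R.

Lemma cnorm_nat n : cnorm (n%:R : R[i]) = n%:R.
Proof. by rewrite -(rmorph_nat (real_complex R)) cnorm_real. Qed.

Lemma nrmZ_nat A n (x : A) : nrm (n%:R *: x) = n%:R * nrm x.
Proof. by rewrite nrmZ cnorm_nat. Qed.

Lemma nrmZ_real A (c : R) (x : A) : 0 <= c -> nrm (c%:C *: x) = c * nrm x.
Proof. by move=> c0; rewrite nrmZ cnorm_real. Qed.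

(** Formally [u = (1 - G) + c H] with [c = i] or [-i] is unitary, because the
    hypotheses say that [1 - G] and [H] are commuting self-adjoint elements with
    [(1 - G)^2 + H^2 = 1].  Left multiplication by [u] is therefore isometric. *)
Lemma nrm_circle_isometry A (G H x : A) (c : R[i]) :
  adj G = G -> adj H = H -> H ** G = G ** H -> G ** G = 2%:R *: G - H ** H ->
  c^*%R = - c -> c * c = -1 ->
  nrm (x - G ** x + c *: (H ** x)) = nrm x.
Proof.
move=> aG aH HG GG cJ cc; apply/eqP.
rewrite -(@eqrXn2 _ 2) ?nrm_ge0// -!nrm_adjl; apply/eqP; congr nrm.
have Hy : adj x ** H ** (x - G ** x) = adj (x - G ** x) ** (H ** x).
  by rewrite adjB adjM aG cmulBr cmulBl !cmulA -(cmulA _ H G) HG !cmulA.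
have yy : adj (x - G ** x) ** (x - G ** x) = adj x ** x - adj x ** H ** (H ** x).
  rewrite adjB adjM aG cmulBr !cmulBl.
  have -> : adj x ** G ** (G ** x) =
      2%:R *: (adj x ** (G ** x)) - adj x ** H ** (H ** x).
    by rewrite cmulA -(cmulA _ G G) GG cmulBr cmulBl cmulZr cmulZl !cmulA.
  rewrite -(cmulA _ G x) scaler_nat mulr2n opprB.
  by rewrite (addrAC (_ + _)) addrK subrKA.
set y := x - G ** x in Hy yy *. clearbody y.
rewrite adjD Defs.adjZ cJ [adj (H ** x)]adjM aH cmulDl !cmulDr yy.
rewrite !cmulZl !cmulZr Hy scalerA mulNr cc opprK scale1r !cmulA.
by rewrite scaleNr addrA addrK subrK.
Qed.

(** For [h] self-adjoint of norm less than 1, let [1 - g] be the square root of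
    [1 - h^2].  The images [G], [H] of [g], [h] satisfy the same relation, so
    [H] is half the difference of two isometric multiplications (up to [i]) and
    has norm at most 1.  Scaling and the C*-identity give the general case. *)
Lemma star_hom_contractive A B (f : A -> B) : star_hom f ->
  forall a, nrm (f a) <= nrm a.
Proof.
case=> fL fM fJ.
have fD x y : f (x + y) = f x + f y by rewrite -(scale1r x) fL// !scale1r.
have f0 : f 0 = 0 by apply: (addrI (f 0)); rewrite -fD !addr0.
have fZ a x : f (a *: x) = a *: f x by rewrite -(addr0 (a *: x)) fL// f0 addr0.
have fB x y : f (x - y) = f x - f y by rewrite -scaleN1r fD fZ scaleN1r.
have bound1 h : adj h = h -> nrm h < 1 -> nrm (f h) <= 1.
  move=> hh h1.
  have [||g [gg g2 gc]] := @sqrt_one_minus _ _ (h ** h).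
  - by rewrite adjM hh.
  - by rewrite (le_lt_trans (nrmM _ _))// mulr_ilt1 ?nrm_ge0.
  have comm : f h ** f g = f g ** f h by rewrite -!fM// gc// cmulA.
  have sq : f g ** f g = 2%:R *: f g - f h ** f h by rewrite -!fM// g2 fB fZ.
  have aG : adj (f g) = f g by rewrite -fJ// gg.
  have aH : adj (f h) = f h by rewrite -fJ// hh.
  have iso := @nrm_circle_isometry _ _ _ (f h) _ aG aH comm sq.
  (* [w = H H]; both isometries are evaluated at [x = H]. *)
  have := iso 'i%R (conjCi _); rewrite -expr2 sqrCi => /(_ erefl).
  have := iso (- 'i%R); rewrite rmorphN /= conjCi => /(_ erefl).
  rewrite mulrNN -expr2 sqrCi => /(_ erefl).
  set y := f h - _; set w := f h ** f h => e1 e2.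
  have : nrm ((2%:R * 'i%R) *: w) <= nrm (f h) + nrm (f h).
    rewrite -[X in _ <= X + _]e2 -[X in _ <= _ + X]e1.
    rewrite (le_trans _ (nrmB _ _))// opprD addrACA subrr add0r -scalerBl.
    by rewrite opprK mulr2n mulrDl !mul1r.
  rewrite -scalerA nrmZ_nat nrmZ.
  have -> : cnorm ('i%R : R[i]) = 1 by apply: cnorm1; rewrite normCi.
  have -> : nrm w = nrm (f h) ^+ 2 by rewrite -nrm_adjl aH.
  by have := nrm_ge0 (f h); nra.
have bound h : adj h = h -> nrm (f h) <= nrm h.
  move=> hh; apply/ler_addgt0Pl => e e0; set t := e + nrm h.
  have t0 : 0 < t by rewrite ltr_pwDl ?nrm_ge0.
  have := bound1 ((t^-1)%:C *: h).
  rewrite fZ !nrmZ_real ?invr_ge0 ?(ltW t0)// Defs.adjZ hh.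
  have -> : (t^-1)%:C^*%R = (t^-1)%:C.
    by apply/CrealP; apply/complex_realP; exists (t^-1).
  rewrite !(mulrC t^-1) ltr_pdivrMr// ler_pdivrMr// !mul1r; apply=> //.
  by rewrite /t ltrDr.
move=> a; rewrite -(@ler_pXn2r _ 2) ?nnegrE ?nrm_ge0// -!nrm_adjl.
by rewrite -fJ// -fM// bound// adjM adjK.
Qed.

End Contractive.

(** * Projections whose sum is a projection *)
Section Projections.
Context {R : realType} {A : cstarAlgType R}.
Implicit Types (e x y : A).

Lemma nrm_projection e : projection e -> nrm e = 0 \/ nrm e = 1.
Proof.
case=> ee e2; have := nrm_adjl e; rewrite ee e2 => n2.
have [->|n0] := eqVneq (nrm e) 0; [by left|right].
by apply: (mulfI n0); rewrite -expr2 -n2 mulr1.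
Qed.

Lemma nrm_projection_le1 e : projection e -> nrm e <= 1.
Proof. by case/nrm_projection => ->. Qed.

Lemma partial_isometry_src (s p : A) : projection p -> adj s ** s = p -> s ** p = s.
Proof.
move=> [ap p2] sp; apply/eqP; rewrite -subr_eq0; apply/eqP; apply: adj_eq0.
rewrite adjB adjM cmulBl !cmulBr ap !cmulA sp.
by rewrite -!(cmulA _ (adj s) s) sp !p2 !subrr.
Qed.

(** In the corner with unit [e], the hypothesis [nrm (e - y) <= 1] makes [y]
    morally nonnegative, so the perturbation [d e + (1 - d) y] has a square
    root.  The parameter [d] brings the norm strictly below 1, where
    [sqrt_one_minus] applies. *)
Lemma corner_sqrt e y (d : R) : projection e -> adj y = y ->
  e ** y = y -> y ** e = y -> nrm (e - y) <= 1 -> 0 < d <= 1 ->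
  exists k, [/\ adj k = k, k ** k = d%:C *: e + (1 - d)%:C *: y
    & forall x, x ** e = e ** x -> x ** y = y ** x -> x ** k = k ** x].
Proof.
case=> ae e2 ay ey ye ny /andP[d0 d1].
have d1' : 0 <= 1 - d by rewrite subr_ge0.
set h := (1 - d)%:C *: (e - y).
have hh : adj h = h.
  rewrite /h Defs.adjZ adjB ae ay.
  by congr (_ *: _); apply/CrealP; apply/complex_realP; exists (1 - d).
have nh : nrm h < 1 by rewrite nrmZ_real//; have := nrm_ge0 (e - y); nra.
have eh : e ** h = h by rewrite cmulZr cmulBr e2 ey.
have he : h ** e = h by rewrite cmulZl cmulBl e2 ye.
have [g [ag g2 gc]] := sqrt_one_minus hh nh.
have eg : e ** g = g ** e by rewrite gc// eh he.
exists (e - e ** g); split.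
- by rewrite adjB adjM ag ae eg.
- have -> : d%:C *: e + (1 - d)%:C *: y = e - h.
    rewrite /h scalerBr opprB addrCA -[X in _ = _ + (X - _)]scale1r -scalerBl.
    have -> : d%:C = 1 - (1 - d)%:C :> R[i] by rewrite rmorphB /= subKr.
    by rewrite addrC.
  have ege : e ** g ** e = e ** g by rewrite -cmulA -eg cmulA e2.
  have egg : e ** g ** (e ** g) = 2%:R *: (e ** g) - h.
    by rewrite cmulA ege -cmulA g2 cmulBr eh cmulZr.
  rewrite cmulBl !cmulBr e2 ege egg cmulA e2 scaler_nat mulr2n opprB.
  by rewrite (addrAC (_ + _)) addrK subrKA.
- move=> x xe xy; rewrite cmulBr cmulBl xe cmulA xe -!cmulA gc//.
  by rewrite /h cmulZr cmulZl cmulBr cmulBl xe xy.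
Qed.

(** The unit of a C*-algebra is an extreme point of its unit ball: [y] and [-y]
    are both nonnegative.  If [k1], [k2] are the commuting square roots of
    [d e + (1 - d) y] and [d e - (1 - d) y], then [w = k1 + i k2] satisfies
    [w^* w = 2 d e], which forces [k1], and with it [y], to be small with [d]. *)
Lemma corner_extreme e y : projection e -> adj y = y ->
  e ** y = y -> y ** e = y -> nrm (e - y) <= 1 -> nrm (e + y) <= 1 -> y = 0.
Proof.
move=> pe ay ey ye nm np.
suff small (d : R) : 0 < d <= 1 -> (1 - d) * nrm y <= 3%:R * d.
  apply: nrm_bound_eq0 => t t0.
  have := small (Num.min (2%:R^-1) (t / 6%:R)).
  rewrite lt_min ge_min invr_gt0 ltr0n divr_gt0//= invf_le1// ler1n /= => /(_ isT).
  have := nrm_ge0 y.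
  case: (leP 2%:R^-1 (t / 6%:R)) => ?; nra.
move=> d01; have /andP[d0 d1] := d01.
have [k1 [ak1 k1k1 k1c]] := corner_sqrt pe ay ey ye nm d01.
have [||||k2 [ak2 k2k2 k2c]] := @corner_sqrt e (- y) d pe _ _ _ _ d01.
- by rewrite adjN ay.
- by rewrite cmulNr ey.
- by rewrite cmulNl ye.
- by rewrite opprK.
have k12 : k1 ** k2 = k2 ** k1.
  apply: k2c; last by rewrite cmulNl cmulNr k1c // ey ye.
  by rewrite k1c // ey ye.
pose w := k1 + 'i%R *: k2.
have aw : adj w = k1 - 'i%R *: k2 by rewrite adjD Defs.adjZ ak1 ak2 conjCi scaleNr.
have ww : adj w ** w = (2%:R * d)%:C *: e.
  rewrite aw cmulBl !cmulDr !cmulZl !cmulZr k12 scalerA -expr2 sqrCi scaleN1r.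
  rewrite opprD opprK addrA addrK k1k1 k2k2 addrACA scalerN subrr addr0 -scalerDl.
  by rewrite -rmorphD mulr_natl mulr2n.
have nw : nrm w ^+ 2 <= 2%:R * d.
  rewrite -nrm_adjl ww nrmZ_real ?mulr_ge0 ?(ltW d0)//.
  by have := nrm_projection_le1 pe; nra.
have nk : nrm k1 <= nrm w.
  have : nrm (2%:R *: k1) <= nrm w + nrm (adj w).
    rewrite (le_trans _ (nrmD _ _))// aw /w addrACA subrr addr0.
    by rewrite scaler_nat mulr2n.
  by rewrite nrmZ_nat nrm_adj; lra.
have nk2 : nrm (k1 ** k1) <= 2%:R * d.
  by have := nrmM k1 k1; have := nrm_ge0 k1; nra.
have <- : nrm ((1 - d)%:C *: y) = (1 - d) * nrm y by rewrite nrmZ_real// subr_ge0.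
have -> : (1 - d)%:C *: y = k1 ** k1 - d%:C *: e by rewrite k1k1 addrAC subrr add0r.
have := nrmB (k1 ** k1) (d%:C *: e); rewrite nrmZ_real ?(ltW d0)//.
by have := nrm_projection_le1 pe; nra.
Qed.

(** Nonnegative elements summing to zero vanish.  With [m] summands, both
    [m e - 2 y] and [m e + 2 y] are sums of [m] contractions: the second because
    [-y] is the sum of the other summands. *)
Lemma corner_sum_eq0 e (ys : seq A) : projection e ->
  (forall y, y \in ys ->
    [/\ adj y = y, e ** y = y, y ** e = y & nrm (e - 2%:R *: y) <= 1]) ->
  \sum_(y <- ys) y = 0 -> forall y, y \in ys -> y = 0.
Proof.
move=> pe H ys0 y yys; have [ay ey ye ny] := H _ yys.
move: ys0; rewrite (big_rem y)//=; set r := rem y ys => sy.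
have rP z : z \in r -> nrm (e - 2%:R *: z) <= 1.
  by move=> /mem_rem /H [].
have rsum : nrm (\sum_(z <- r) (e - 2%:R *: z)) <= (size r)%:R.
  rewrite (le_trans (nrm_sum _ _ _))// -sum1_size natr_sum.
  by rewrite [leLHS]big_seq [leRHS]big_seq ler_sum.
have rE : \sum_(z <- r) (e - 2%:R *: z) = (size r)%:R *: e + 2%:R *: y.
  rewrite sumrB big_const_seq count_predT iter_addr_0 scaler_nat -scaler_sumr.
  by rewrite -[in RHS](addrK (\sum_(z <- r) z) y) sy sub0r scalerN.
have ne := nrm_projection_le1 pe.
pose m := (size r).+1; pose c : R := 2%:R / m%:R.
have m0 : 0 < m%:R :> R by rewrite ltr0n.
have c0 : 0 < c by rewrite divr_gt0.
have mE : (m%:R^-1)%:C *: (m%:R *: e) = e.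
  by rewrite scalerA -(rmorph_nat (real_complex R)) -rmorphM mulVf ?gt_eqF// scale1r.
have cE z : c%:C *: z = (m%:R^-1)%:C *: (2%:R *: z).
  by rewrite scalerA -(rmorph_nat (real_complex R)) -rmorphM mulrC.
have mS : m%:R *: e = e + (size r)%:R *: e.
  by rewrite /m -natr1 addrC scalerDl scale1r.
suff : c%:C *: y = 0.
  move=> cy0; apply: nrm0_eq0; apply/eqP.
  have := congr1 nrm cy0; rewrite nrm0 nrmZ_real ?(ltW c0)// => /eqP.
  by rewrite mulf_eq0 gt_eqF.
apply: (corner_extreme pe).
- rewrite Defs.adjZ ay; congr (_ *: _).
  by apply/CrealP; apply/complex_realP; exists c.
- by rewrite cmulZr ey.
- by rewrite cmulZl ye.
- rewrite cE -{1}mE -scalerBr nrmZ_real ?invr_ge0 ?(ltW m0)//.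
  rewrite mulrC ler_pdivrMr// mul1r mS addrAC (le_trans (nrmD _ _))// nrmZ_nat.
  rewrite /m -(nat1r (size r)) lerD//.
  by rewrite ler_piMr.
- rewrite cE -{1}mE -scalerDr nrmZ_real ?invr_ge0 ?(ltW m0)//.
  rewrite mulrC ler_pdivrMr// mul1r mS -addrA -rE (le_trans (nrmD _ _))//.
  by rewrite /m -(nat1r (size r)) lerD.
Qed.

(** [1 - 2 p] is a unitary, so its compression to the corner of [e] is a
    contraction; this expresses [e p e >= 0] in the form required by
    [corner_sum_eq0]. *)
Lemma nrm_reflection e p : projection e -> projection p ->
  nrm (e - 2%:R *: (e ** p ** e)) <= 1.
Proof.
move=> pe [ap p2]; have [ae e2] := pe.
have ne := nrm_projection_le1 pe.
have n1 : nrm (e - 2%:R *: (p ** e)) <= 1.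
  rewrite -(@expr_le1 _ 2) ?nrm_ge0// -nrm_adjl.
  suff -> : adj (e - 2%:R *: (p ** e)) ** (e - 2%:R *: (p ** e)) = e by [].
  rewrite adjB Defs.adjZ adjM ae ap rmorph_nat cmulBl !cmulBr e2.
  rewrite !cmulZl !cmulZr !cmulA -(cmulA e p p) p2.
  by rewrite !scaler_nat !mulr2n opprB addrK subrK.
have -> : e - 2%:R *: (e ** p ** e) = e ** (e - 2%:R *: (p ** e)).
  by rewrite cmulBr e2 cmulZr cmulA.
by rewrite (le_trans (nrmM _ _))// mulr_ile1 ?nrm_ge0.
Qed.

(** Compress [p = \sum_i P i] by [e = P i]: the summand for [i] itself gives
    [e], whence [(e - e p e) + \sum_(j != i) e (P j) e = 0].  All terms are
    nonnegative in the corner of [e] (here [2 p - 1] plays for [e - e p e] the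
    role that [1 - 2 P j] plays for the others), so each of them is zero. *)
Lemma projection_sum (I : eqType) (s : seq I) (P : I -> A) (p : A) :
  uniq s -> projection p -> (forall i, i \in s -> projection (P i)) ->
  p = \sum_(i <- s) P i -> forall i, i \in s ->
  p ** P i = P i /\ forall j, j \in s -> j != i -> P j ** P i = 0.
Proof.
move=> us pp PP ps i is_; have pe := PP i is_.
set e := P i in pe *; have [ae e2] := pe; have [ap p2] := pp.
pose ys := (e - e ** p ** e) :: [seq e ** P j ** e | j <- rem i s].
have ys0 : \sum_(y <- ys) y = 0.
  rewrite /ys big_cons big_map -cmul_suml -cmul_sumr.
  have -> : \sum_(j <- rem i s) P j = p - e.
    by rewrite ps [in RHS](big_rem i)//= addrAC subrr add0r.
  by rewrite cmulBr cmulBl !e2 subrKA subrr.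
have ysP y : y \in ys ->
    [/\ adj y = y, e ** y = y, y ** e = y & nrm (e - 2%:R *: y) <= 1].
  have self q : projection q -> [/\ adj (e ** q ** e) = e ** q ** e,
      e ** (e ** q ** e) = e ** q ** e & e ** q ** e ** e = e ** q ** e].
    by move=> [aq q2]; rewrite !adjM ae aq !cmulA e2 -(cmulA _ e e) e2.
  rewrite inE => /orP[/eqP ->|/mapP[j jr ->]].
    have [s1 s2 s3] := self _ pp.
    rewrite adjB s1 cmulBr s2 cmulBl s3 ae e2; split=> //.
    rewrite scalerBr opprB addrCA [X in _ + (e - X)]scaler_nat mulr2n.
    by rewrite opprD addNKr -nrmN opprB nrm_reflection.
  have pj : projection (P j) by apply: PP; apply: mem_rem jr.
  by have [s1 s2 s3] := self _ pj; split=> //; apply: nrm_reflection.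
have y0 := corner_sum_eq0 pe ysP ys0.
split.
  apply/eqP; rewrite eq_sym -subr_eq0; apply/eqP; apply: adj_eq0.
  rewrite adjB adjM ae ap cmulBl !cmulBr e2 !cmulA -(cmulA e p p) p2 subrr subr0.
  by apply: y0; rewrite inE eqxx.
move=> j js ji; apply: adj_eq0; have [aj j2] := PP _ js.
rewrite adjM ae aj cmulA -(cmulA e) j2; apply: y0.
by rewrite inE; apply/orP; right; apply/mapP; exists j; rewrite // mem_rem_uniq// !inE ji.
Qed.

End Projections.

(** * Norm comparison by taking powers *)
Section PowerTrick.
Context {R : realType}.

Lemma bernoulli_le (d : R) m : 0 <= d -> 1 + m%:R * d <= (1 + d) ^+ m.
Proof.
move=> d0; elim: m => [|m IH]; first by rewrite mul0r addr0 expr0.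
rewrite exprS -(nat1r m) mulrDl mul1r.
have m0 : 0 <= m%:R * d :> R by rewrite mulr_ge0.
have := mulr_ge0 d0 m0; have := ler_wpM2l d0 IH; nra.
Qed.

Lemma le1_of_powers (x C : R) : 0 <= x ->
  (forall k, x ^+ (2 ^ k.+1) <= C * (2 ^ k)%:R) -> x <= 1.
Proof.
move=> x0 xC; rewrite leNgt; apply/negP => x1.
pose d := x - 1; have d0 : 0 < d by rewrite subr_gt0.
have key k : (2 ^ k)%:R * d ^+ 2 <= C.
  have := xC k; have := @bernoulli_le d (2 ^ k) (ltW d0).
  have -> : 1 + d = x by rewrite /d subrKC.
  rewrite expnS mulnC exprM; set m : R := (2 ^ k)%:R; set y := x ^+ _ => h1 h2.
  have m0 : 0 < m by rewrite ltr0n expn_gt0.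
  have md : 0 <= m * d by rewrite mulr_ge0 ?ltW.
  have h3 : (m * d) ^+ 2 <= y ^+ 2 by rewrite ler_pXn2r ?nnegrE//; lra.
  rewrite -(ler_pM2l m0) (mulrC m C); apply: le_trans h2; apply: le_trans h3.
  by rewrite exprMn (expr2 m) mulrA lexx.
have d20 : 0 < d ^+ 2 by rewrite exprn_gt0.
pose k := Num.truncn (C / d ^+ 2).
have /(lt_le_trans) := truncnS_gt (C / d ^+ 2).
move=> /(_ (2 ^ k)%:R); rewrite ler_nat => /(_ (ltn_expl k (ltnSn 1))).
by rewrite ltr_pdivrMr// ltNge key.
Qed.

Variables (A B : cstarAlgType R).

Definition sqpow {C : cstarAlgType R} k (x : C) := iter k (fun y => y ** y) (adj x ** x).

Lemma adj_sqpow (C : cstarAlgType R) k (x : C) : adj (sqpow k x) = sqpow k x.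
Proof.
elim: k => [|k IH]; first by rewrite adjM adjK.
by rewrite [sqpow _ _]/= -/(sqpow k x) adjM IH.
Qed.

Lemma nrm_sqpow (C : cstarAlgType R) k (x : C) : nrm (sqpow k x) = nrm x ^+ (2 ^ k.+1).
Proof.
elim: k => [|k IH]; first exact: nrm_adjl.
by rewrite /= -/(sqpow k x) -{1}adj_sqpow nrm_adjl IH -exprM -expnSr.
Qed.

(** The C*-identity turns the norm of [b] into the [2^(k+1)]-th root of the norm
    of [sqpow k b].  Passing to such powers multiplies the filtration degree by
    [2^(k+1)], so a constant growing linearly in the degree disappears when the
    root is taken. *)
Lemma nrm_le_of_linear_growth (K : nat -> A -> B -> Prop) (C : R) :
  (forall n m a a' b b', K n a b -> K m a' b' -> K (n + m)%N (a ** a') (b ** b')) ->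
  (forall n a b, K n a b -> K n (adj a) (adj b)) ->
  0 <= C ->
  (forall n a b, K n a b -> nrm b <= C * n.+1%:R * nrm a) ->
  forall n a b, K n a b -> nrm b <= nrm a.
Proof.
move=> KM KJ C0 Kb n a b Kab.
have [a0|a0] := eqVneq (nrm a) 0.
  by have := Kb _ _ _ Kab; rewrite a0 mulr0.
have {}a0 : 0 < nrm a by rewrite lt_def a0 nrm_ge0.
have Kpow k : K ((n + n) * 2 ^ k)%N (sqpow k a) (sqpow k b).
  elim: k => [|k IH]; first by rewrite muln1; apply: KM => //; apply: KJ.
  by rewrite expnS mul2n -addnn mulnDr /=; apply: KM.
rewrite -(mul1r (nrm a)) -ler_pdivrMr//.
apply: (@le1_of_powers _ (C * (n + n).+1%:R)); first by rewrite divr_ge0 ?nrm_ge0.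
move=> k; have := Kb _ _ _ (Kpow k).
rewrite !nrm_sqpow expr_div_n ler_pdivrMr ?exprn_gt0// => /le_trans; apply.
rewrite ler_pM2r ?exprn_gt0// -mulrA ler_wpM2l// -natrM ler_nat.
by rewrite mulSn addnC -addn1 leq_add2l expn_gt0.
Qed.

End PowerTrick.

(** * The calculus of path monomials *)
Section Monomials.
Context {R : realType} (E : digraph) (ins : vertex E -> seq (edge E)).
Local Notation V := (vertex E).
Local Notation Ed := (edge E).

(** The relations are indexed by finite lists [ins v] of incoming edges that may
    be smaller than the full set of edges into [v]; this realises the graph from
    which a cutting set has been deleted while keeping the same type of edges.
    A vertex with an empty list carries no summation relation, like a source. *)
Record ck_relations (A : cstarAlgType R) (p : V -> A) (s : Ed -> A) : Prop :=
  CKRelations {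
  ck_proj : forall v, projection (p v);
  ck_orth : forall v w, v <> w -> p v ** p w = 0;
  ck_src : forall e, adj (s e) ** s e = p (src e);
  ck_edge_orth : forall e f, e <> f -> adj (s e) ** s f = 0;
  ck_rng : forall e, p (rng e) ** s e = s e;
  ck_sum : forall v, ins v != [::] -> p v = \sum_(e <- ins v) (s e ** adj (s e)) }.

(** A path is a list of edges together with its source, so that the vertices are
    the empty lists; [path_range] is its range. *)
Definition path_range (mu : seq Ed) (v : V) : V := if mu is e :: _ then rng e else v.

Fixpoint valid (mu : seq Ed) (v : V) : bool :=
  if mu is e :: mu' then
    [&& e \in ins (rng e), src e == path_range mu' v & valid mu' v]
  else true.

Lemma path_range_cat mu nu v : path_range (mu ++ nu) v = path_range mu (path_range nu v).
Proof. by case: mu. Qed.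

Lemma valid_cat mu nu v :
  valid (mu ++ nu) v = valid mu (path_range nu v) && valid nu v.
Proof. by elim: mu => //= e mu ->; rewrite path_range_cat !andbA. Qed.

(** The triple [(mu, nu, v)] stands for the product of [s_mu] and the adjoint
    of [s_nu], both paths having source [v]. *)
Definition mono := (seq Ed * seq Ed * V)%type.

Definition vmono (m : mono) := valid m.1.1 m.2 && valid m.1.2 m.2.

Section OneFamily.
Context {A : cstarAlgType R} (p : V -> A) (s : Ed -> A).

Definition path_elt (mu : seq Ed) (v : V) : A := foldr (fun e x => s e ** x) (p v) mu.

Definition mono_elt (m : mono) : A :=
  path_elt m.1.1 m.2 ** adj (path_elt m.1.2 m.2).

Hypothesis ck : ck_relations p s.

Lemma ck_adj_proj v : adj (p v) = p v.
Proof. by have [] := ck_proj ck v. Qed.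

Lemma ck_idem v : p v ** p v = p v.
Proof. by have [] := ck_proj ck v. Qed.

Lemma ck_srcr e : s e ** p (src e) = s e.
Proof. exact: partial_isometry_src (ck_proj ck _) (ck_src ck _). Qed.

Lemma range_path_elt mu v : p (path_range mu v) ** path_elt mu v = path_elt mu v.
Proof. by case: mu => [|e mu] /=; rewrite ?ck_idem// cmulA (ck_rng ck). Qed.

Lemma path_elt_src mu v : path_elt mu v ** p v = path_elt mu v.
Proof. by elim: mu => [|e mu IH] /=; rewrite ?ck_idem// -cmulA IH. Qed.

Lemma path_elt_cat mu nu v :
  path_elt mu (path_range nu v) ** path_elt nu v = path_elt (mu ++ nu) v.
Proof. by elim: mu => [|e mu IH] /=; rewrite ?range_path_elt// -cmulA IH. Qed.

Lemma path_elt_isometry mu v : valid mu v ->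
  adj (path_elt mu v) ** path_elt mu v = p v.
Proof.
elim: mu => [|e mu IH] /=; first by rewrite ck_adj_proj ck_idem.
case/and3P=> _ /eqP se vmu; rewrite adjM -cmulA (cmulA _ (s e)) (ck_src ck) se.
by rewrite range_path_elt IH.
Qed.

Lemma path_elt_range_neq mu v w : w <> path_range mu v -> p w ** path_elt mu v = 0.
Proof. by move=> wv; rewrite -range_path_elt cmulA (ck_orth ck wv) cmul0l. Qed.

Lemma nrm_vertex_le1 v : nrm (p v) <= 1.
Proof. exact: nrm_projection_le1 (ck_proj ck v). Qed.

Lemma nrm_path_elt mu v : valid mu v -> nrm (path_elt mu v) <= 1.
Proof.
move=> vmu; rewrite -(@expr_le1 _ 2) ?nrm_ge0// -nrm_adjl.
by rewrite path_elt_isometry// nrm_vertex_le1.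
Qed.

Lemma nrm_mono_elt m : vmono m -> nrm (mono_elt m) <= 1.
Proof.
case/andP=> v1 v2; rewrite (le_trans (nrmM _ _))// nrm_adj.
by rewrite mulr_ile1 ?nrm_ge0 ?nrm_path_elt.
Qed.

Lemma adj_mono_elt m : adj (mono_elt m) = mono_elt (m.1.2, m.1.1, m.2).
Proof. by rewrite /mono_elt adjM adjK. Qed.

End OneFamily.

(** The alternatives depend on the paths only, which is why the families are
    quantified inside each of them: the same case then holds simultaneously for
    the two families that are compared later. *)
Lemma path_elt_cancel (nu : seq Ed) v (al : seq Ed) w : valid nu v -> valid al w ->
  [\/ exists al', [/\ al = nu ++ al', path_range al' w = v
      & forall (A : cstarAlgType R) (p : V -> A) (s : Ed -> A), ck_relations p s ->
          adj (path_elt p s nu v) ** path_elt p s al w = path_elt p s al' w],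
      exists nu', [/\ nu = al ++ nu', path_range nu' v = w
      & forall (A : cstarAlgType R) (p : V -> A) (s : Ed -> A), ck_relations p s ->
          adj (path_elt p s nu v) ** path_elt p s al w = adj (path_elt p s nu' v)]
    | forall (A : cstarAlgType R) (p : V -> A) (s : Ed -> A), ck_relations p s ->
          adj (path_elt p s nu v) ** path_elt p s al w = 0].
Proof.
elim: nu al => [|e nu IH] al.
  move=> _ _; have [vE|/eqP vN] := eqVneq v (path_range al w).
    apply: Or31; exists al; split=> // A p s ck /=.
    by rewrite (ck_adj_proj ck) vE (range_path_elt ck).
  apply: Or33 => A p s ck /=.
  by rewrite (ck_adj_proj ck) (path_elt_range_neq ck).
case: al => [|f al].
  move=> _ _; have [wE|/eqP wN] := eqVneq w (path_range (e :: nu) v).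
    apply: Or32; exists (e :: nu); split=> // A p s ck.
    by rewrite [path_elt p s [::] w]/= -(ck_adj_proj ck) -adjM wE (range_path_elt ck).
  apply: Or33 => A p s ck.
  rewrite [path_elt p s [::] w]/= -(ck_adj_proj ck) -adjM.
  by rewrite (path_elt_range_neq ck)// adj0.
move=> /= /and3P[_ _ vnu] /and3P[_ /eqP sf val].
have [ef|/eqP ef] := eqVneq e f; last first.
  apply: Or33 => A p s ck.
  by rewrite adjM -cmulA (cmulA _ (s f)) (ck_edge_orth ck ef) cmul0l cmul0r.
subst f.
have red (A : cstarAlgType R) (p : V -> A) (s : Ed -> A) : ck_relations p s ->
    adj (s e ** path_elt p s nu v) ** (s e ** path_elt p s al w) =
    adj (path_elt p s nu v) ** path_elt p s al w.
  move=> ck; rewrite adjM -cmulA (cmulA _ (s e)) (ck_src ck) sf.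
  by rewrite (range_path_elt ck).
case: (IH al vnu val) => [[al' [alE h1 h2]]|[nu' [nuE h1 h2]]|h].
- apply: Or31; exists al'; split=> [|//|A p s ck]; first by rewrite alE.
  by rewrite red ?h2.
- apply: Or32; exists nu'; split=> [|//|A p s ck]; first by rewrite nuE.
  by rewrite red ?h2.
- by apply: Or33 => A p s ck; rewrite red ?h.
Qed.

(** The balance of the sizes says that the degree, that is the difference of the
    two lengths, is additive under multiplication of monomials. *)
Lemma mono_eltM m1 m2 : vmono m1 -> vmono m2 ->
  (exists m, [/\ vmono m,
     (size m.1.1 <= size m1.1.1 + size m2.1.1)%N,
     (size m.1.2 <= size m1.1.2 + size m2.1.2)%N,
     (size m.1.1 + size m1.1.2 + size m2.1.2 =
      size m.1.2 + size m1.1.1 + size m2.1.1)%N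
   & forall (A : cstarAlgType R) (p : V -> A) (s : Ed -> A), ck_relations p s ->
       mono_elt p s m1 ** mono_elt p s m2 = mono_elt p s m])
  \/ forall (A : cstarAlgType R) (p : V -> A) (s : Ed -> A), ck_relations p s ->
       mono_elt p s m1 ** mono_elt p s m2 = 0.
Proof.
case: m1 m2 => [[mu nu] v] [[al be] w] /andP[/= vmu vnu] /andP[/= val vbe].
case: (path_elt_cancel vnu val) => [[al' [alE r h]]|[nu' [nuE r h]]|h].
- left; exists (mu ++ al', be, w); subst al.
  move: val; rewrite valid_cat r => /andP[_ val'].
  split; rewrite /vmono /= ?valid_cat ?r ?vmu ?val' ?size_cat//; try lia.
  move=> A p s ck; rewrite /mono_elt /= -(path_elt_cat ck mu) r.
  by rewrite -(h _ _ _ ck) !cmulA.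
- left; exists (mu, be ++ nu', v); subst nu.
  move: vnu; rewrite valid_cat r => /andP[_ vnu'].
  split; rewrite /vmono /= ?valid_cat ?r ?vbe ?vmu ?vnu' ?size_cat//; try lia.
  move=> A p s ck; rewrite /mono_elt /= -(path_elt_cat ck be) r adjM.
  by rewrite -(h _ _ _ ck) !cmulA.
- right=> A p s ck.
  rewrite /mono_elt /= -cmulA (cmulA (adj _) (path_elt _ _ al w)).
  by rewrite (h _ _ _ ck) cmul0l cmul0r.
Qed.

End Monomials.

(** * Pairs of elements with the same formal expression *)
Section Span.
Context {R : realType} (E : digraph) (ins : vertex E -> seq (edge E)).
Context {A B : cstarAlgType R} (p : vertex E -> A) (s : edge E -> A)
  (q : vertex E -> B) (t : edge E -> B).
Hypotheses (cks : ck_relations ins p s) (ckt : ck_relations ins q t).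

(** [span P a b] holds when one linear combination of monomials in [P] evaluates
    to [a] in the first family and to [b] in the second: it is the graph of the
    would-be homomorphism on the dense subalgebra. *)
Inductive span (P : mono E -> Prop) : A -> B -> Prop :=
| span0 : span P 0 0
| spanS c m a b : P m -> span P a b ->
    span P (c *: mono_elt p s m + a) (c *: mono_elt q t m + b).

Lemma span_mono (P Q : mono E -> Prop) a b :
  (forall m, P m -> Q m) -> span P a b -> span Q a b.
Proof. by move=> PQ; elim=> [|c m a' b' /PQ Qm _ IH]; [apply: span0|apply: spanS]. Qed.

Lemma spanD P a b a' b' : span P a b -> span P a' b' -> span P (a + a') (b + b').
Proof.
move=> + h; elim=> [|c m x y Pm _ IH]; first by rewrite !add0r.
by rewrite -!addrA; apply: spanS.
Qed.

Lemma spanZ P c a b : span P a b -> span P (c *: a) (c *: b).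
Proof.
elim=> [|d m x y Pm _ IH]; first by rewrite !scaler0; apply: span0.
by rewrite !scalerDr !scalerA; apply: spanS.
Qed.

Lemma span_mono_elt (P : mono E -> Prop) m :
  P m -> span P (mono_elt p s m) (mono_elt q t m).
Proof.
move=> Pm; rewrite -[mono_elt p s m]addr0 -[mono_elt q t m]addr0.
rewrite -[mono_elt p s m]scale1r -[mono_elt q t m]scale1r.
by apply: spanS => //; apply: span0.
Qed.

Lemma span_sum P (I : eqType) (r : seq I) (F : I -> A) (G : I -> B) :
  (forall i, i \in r -> span P (F i) (G i)) ->
  span P (\sum_(i <- r) F i) (\sum_(i <- r) G i).
Proof.
elim: r => [|i r IH] H; first by rewrite !big_nil; apply: span0.
rewrite !big_cons; apply: spanD; first by apply: H; rewrite inE eqxx.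
by apply: IH => j jr; apply: H; rewrite inE jr orbT.
Qed.

Lemma span_adj (P Q : mono E -> Prop) a b :
  (forall m, P m -> Q (m.1.2, m.1.1, m.2)) ->
  span P a b -> span Q (adj a) (adj b).
Proof.
move=> PQ; elim=> [|c m x y /PQ Qm _ IH]; first by rewrite !adj0; apply: span0.
by rewrite !adjD !Defs.adjZ !adj_mono_elt; apply: spanS.
Qed.

Lemma spanM (P Q S : mono E -> Prop) a b a' b' :
  (forall m1 m2, P m1 -> Q m2 ->
    (exists m, [/\ S m, mono_elt p s m1 ** mono_elt p s m2 = mono_elt p s m
        & mono_elt q t m1 ** mono_elt q t m2 = mono_elt q t m])
    \/ (mono_elt p s m1 ** mono_elt p s m2 = 0 /\
        mono_elt q t m1 ** mono_elt q t m2 = 0)) ->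
  span P a b -> span Q a' b' -> span S (a ** a') (b ** b').
Proof.
move=> PQS; elim=> [|c m x y Pm _ IH] h; first by rewrite !cmul0l; apply: span0.
rewrite !cmulDl; apply: spanD; last exact: IH.
rewrite !cmulZl; apply: spanZ; elim: h => [|d m' x' y' Qm' _ IH'].
  by rewrite !cmul0r; apply: span0.
rewrite !cmulDr !cmulZr; apply: spanD => //; apply: spanZ.
case: (PQS _ _ Pm Qm') => [[m'' [Sm -> ->]]|[-> ->]]; last exact: span0.
exact: span_mono_elt.
Qed.

End Span.

(** * The core: balanced monomials *)
Section Core.
Context {R : realType} (E : digraph) (ins : vertex E -> seq (edge E)).
Local Notation V := (vertex E).
Local Notation Ed := (edge E).
Hypothesis ins_rng : forall v e, e \in ins v -> rng e = v.

(** A path that cannot be extended within length [N]: it has length [N], or it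
    stops earlier at a vertex that receives no edge. *)
Definition full_level N (mu : seq Ed) (v : V) : bool :=
  (size mu == N) || ((size mu <= N)%N && (ins v == [::])).

Lemma full_level_no_extension N mu nu v w : full_level N mu v ->
  full_level N (mu ++ nu) w -> valid ins nu w -> path_range nu w = v -> nu = [::].
Proof.
case: nu => // f nu; rewrite /full_level size_cat /= => l1 l2 /and3P[fi _ _] rf.
have iv : (ins v == [::]) = false by rewrite -rf; case: (ins (rng f)) fi.
by move: l1 l2; rewrite iv andbF orbF; lia.
Qed.

(** Two distinct paths of full level are never extensions of one another, so the
    corresponding monomials multiply like matrix units. *)
Lemma path_elt_matrix_units (A : cstarAlgType R) (p : V -> A) (s : Ed -> A) N nu v al w :
  ck_relations ins p s -> valid ins nu v -> valid ins al w ->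
  full_level N nu v -> full_level N al w ->
  adj (path_elt p s nu v) ** path_elt p s al w =
  if (nu, v) == (al, w) then p v else 0.
Proof.
move=> ck vnu val lnu lal.
case: eqP => [[<- <-]|ne]; first exact: (path_elt_isometry ck).
case: (path_elt_cancel (R := R) vnu val) => [[al' [alE r _]]|[nu' [nuE r _]]|-> //].
- have val' : valid ins al' w by move: val; rewrite alE valid_cat => /andP[].
  have al0 : al' = [::].
    by apply: (@full_level_no_extension N nu _ v w) => //; rewrite -alE.
  by case: ne; rewrite alE -r al0 cats0.
- have vnu' : valid ins nu' v by move: vnu; rewrite nuE valid_cat => /andP[].
  have nu0 : nu' = [::].
    by apply: (@full_level_no_extension N al _ w v) => //; rewrite -nuE.
  by case: ne; rewrite nuE -r nu0 cats0.
Qed.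

(** The summation relation at [v], inserted between the two halves. *)
Lemma mono_elt_expand (A : cstarAlgType R) (p : V -> A) (s : Ed -> A) mu nu v :
  ck_relations ins p s -> ins v != [::] ->
  mono_elt p s (mu, nu, v) =
  \sum_(e <- ins v) mono_elt p s (mu ++ [:: e], nu ++ [:: e], src e).
Proof.
move=> ck iv; rewrite {1}/mono_elt /= -(path_elt_src ck mu) (ck_sum ck iv).
rewrite cmul_sumr cmul_suml big_seq [RHS]big_seq; apply: eq_bigr => e /ins_rng re.
rewrite /mono_elt /= -!(path_elt_cat ck) /= (ck_srcr ck) re adjM.
by rewrite !cmulA.
Qed.

Context {A B : cstarAlgType R} (p : V -> A) (s : Ed -> A) (q : V -> B) (t : Ed -> B).
Hypotheses (cks : ck_relations ins p s) (ckt : ck_relations ins q t).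
Hypothesis p_neq0 : forall v, p v <> 0.

Definition level_mono N (m : mono E) :=
  [/\ vmono ins m, full_level N m.1.1 m.2 & full_level N m.1.2 m.2].

(** Both paths are lengthened by the same edges until they reach full level;
    equality of the two lengths guarantees that they get there together. *)
Lemma span_expand N m : vmono ins m -> size m.1.1 = size m.1.2 ->
  (size m.1.1 <= N)%N ->
  span p s q t (level_mono N) (mono_elt p s m) (mono_elt q t m).
Proof.
move: {2}(N - size m.1.1)%N (erefl (N - size m.1.1)%N) => k.
elim: k m => [|k IH] [[mu nu] v] /= kE vm mn muN.
  apply: span_mono_elt; split=> //; rewrite /full_level /= -?mn; apply/orP; left; lia.
have [iv|iv] := eqVneq (ins v) [::].
  by apply: span_mono_elt; split; rewrite //= /full_level /= -?mn muN iv eqxx orbT.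
rewrite !mono_elt_expand//; apply: span_sum => e ei.
have re := ins_rng ei; move: vm; rewrite /vmono /= => /andP[vmu vnu].
apply: IH; rewrite /vmono /= ?valid_cat ?size_cat /= ?re ?vmu ?vnu ?ei ?eqxx //=; lia.
Qed.

Lemma nrm_vertex v : nrm (p v) = 1.
Proof.
by case: (nrm_projection (ck_proj cks v)) => // /nrm0_eq0 /p_neq0.
Qed.

Lemma span_coeff (P : mono E -> Prop) (Q : seq (mono E)) a b : uniq Q ->
  (forall m, P m -> m \in Q) -> span p s q t P a b ->
  exists c : mono E -> R[i],
    a = \sum_(m <- Q) c m *: mono_elt p s m /\
    b = \sum_(m <- Q) c m *: mono_elt q t m.
Proof.
move=> uQ PQ; elim=> [|c0 m0 a' b' Pm _ [c [aE bE]]].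
  by exists (fun=> 0); split; rewrite big1// => m _; rewrite scale0r.
have m0Q := PQ _ Pm.
exists (fun m => (if m == m0 then c0 else 0) + c m).
have one (C : lmodType R[i]) (F : mono E -> C) :
    \sum_(m <- Q) ((if m == m0 then c0 else 0) + c m) *: F m =
    c0 *: F m0 + \sum_(m <- Q) c m *: F m.
  under eq_bigr do rewrite scalerDl.
  rewrite big_split /=; congr (_ + _).
  rewrite (bigD1_seq m0)//= eqxx big1 ?addr0// => m /negbTE ->.
  by rewrite scale0r.
by rewrite !one -aE -bE.
Qed.

(** From here on the paths range over a finite set [J], so that the monomials
    [units] span a finite-dimensional algebra of block matrices. *)
Section MatrixUnits.
Variables (N : nat) (J : seq (seq Ed * V)).
Hypothesis JP : forall i, i \in J -> valid ins i.1 i.2 /\ full_level N i.1 i.2.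

Definition unit_in (m : mono E) := ((m.1.1, m.2) \in J) && ((m.1.2, m.2) \in J).

Definition units : seq (mono E) :=
  [seq m <- undup [seq (i.1, j.1, i.2) | i <- J, j <- J] | unit_in m].

Lemma mem_units m : (m \in units) = unit_in m.
Proof.
rewrite mem_filter mem_undup; case: m => [[mu nu] v].
case: (boolP (unit_in _)) => //= /andP[/= h1 h2].
by apply/allpairsP; exists ((mu, v), (nu, v)).
Qed.

Lemma unit_in_valid m : unit_in m -> vmono ins m.
Proof. by case/andP=> /JP[/= v1 _] /JP[/= v2 _]; rewrite /vmono v1 v2. Qed.

(** Compressing by the two paths of [m] isolates the coefficient of [m]. *)
Lemma mono_elt_sandwich (C : cstarAlgType R) (r : V -> C) (u : Ed -> C) m m' :
  ck_relations ins r u -> unit_in m -> unit_in m' ->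
  adj (path_elt r u m.1.1 m.2) ** mono_elt r u m' ** path_elt r u m.1.2 m.2 =
  if m == m' then r m.2 else 0.
Proof.
case: m m' => [[mu nu] v] [[al be] w] ck /andP[/= /JP[/= v1 l1] /JP[/= v2 l2]].
case/andP=> /= /JP[/= v3 l3] /JP[/= v4 l4].
rewrite /mono_elt /= cmulA (path_elt_matrix_units ck v1 v3 l1 l3).
rewrite -cmulA (path_elt_matrix_units ck v4 v2 l4 l2) !xpair_eqE.
case: (eqVneq mu al) => _ /=; last by rewrite cmul0l.
case: (eqVneq v w) => [<-|_] /=; last by rewrite !andbF cmul0l.
rewrite !andbT (eq_sym be); case: (eqVneq nu be) => _; last by rewrite cmul0r.
exact: (ck_idem ck).
Qed.

(** Coefficients are bounded by the norm in the first algebra because its vertex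
    projections have norm 1, and they bound the norm in the second one. *)
Lemma nrm_units_bound a b : span p s q t unit_in a b ->
  nrm b <= (size units)%:R * nrm a.
Proof.
move=> sab; have [||c [aE bE]] := @span_coeff _ units _ _ _ _ sab.
- by rewrite filter_uniq// undup_uniq.
- by move=> m mP; rewrite mem_units.
have cP m : m \in units -> cnorm (c m) <= nrm a.
  move=> mu; have mP : unit_in m by rewrite -mem_units.
  have -> : cnorm (c m) = nrm (c m *: p m.2) by rewrite nrmZ nrm_vertex mulr1.
  have -> : c m *: p m.2 =
      adj (path_elt p s m.1.1 m.2) ** a ** path_elt p s m.1.2 m.2.
    rewrite aE cmul_sumr cmul_suml (bigD1_seq m)//=; last first.
      by rewrite filter_uniq// undup_uniq.
    rewrite cmulZr cmulZl mono_elt_sandwich// eqxx big_seq_cond big1 ?addr0//.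
    move=> m' /andP[]; rewrite mem_units => m'P m'm.
    by rewrite cmulZr cmulZl mono_elt_sandwich// eq_sym (negbTE m'm) scaler0.
  have /andP[v1 v2] := unit_in_valid mP.
  have := nrmM (adj (path_elt p s m.1.1 m.2) ** a) (path_elt p s m.1.2 m.2).
  have := nrmM (adj (path_elt p s m.1.1 m.2)) a; rewrite nrm_adj.
  have := nrm_path_elt cks v1; have := nrm_path_elt cks v2.
  set x := nrm (path_elt _ _ _ _); set y := nrm (path_elt _ _ _ _).
  set z := nrm (_ ** a); have : 0 <= x by exact: nrm_ge0.
  have : 0 <= y by exact: nrm_ge0.
  have : 0 <= nrm a by exact: nrm_ge0.
  have : 0 <= z by exact: nrm_ge0.
  nra.
rewrite bE (le_trans (nrm_sum _ _ _))// -sum1_size natr_sum mulr_suml.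
rewrite [leLHS]big_seq [leRHS]big_seq ler_sum// => m mu.
rewrite mul1r nrmZ -[leRHS]mulr1 ler_pM ?nrm_ge0 ?cP//.
  by rewrite -lecR -cnormE normr_ge0.
by apply: (nrm_mono_elt ckt); apply: unit_in_valid; rewrite -mem_units.
Qed.

Lemma unitsM m1 m2 : unit_in m1 -> unit_in m2 ->
  (exists m, [/\ unit_in m, mono_elt p s m1 ** mono_elt p s m2 = mono_elt p s m
      & mono_elt q t m1 ** mono_elt q t m2 = mono_elt q t m])
  \/ (mono_elt p s m1 ** mono_elt p s m2 = 0 /\
      mono_elt q t m1 ** mono_elt q t m2 = 0).
Proof.
case: m1 m2 => [[mu nu] v] [[al be] w] /andP[/= Jmu Jnu] /andP[/= Jal Jbe].
have [v2 l2] := JP Jnu; have [v3 l3] := JP Jal.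
have prod (C : cstarAlgType R) (r : V -> C) (u : Ed -> C) : ck_relations ins r u ->
    mono_elt r u (mu, nu, v) ** mono_elt r u (al, be, w) =
    path_elt r u mu v ** (if (nu, v) == (al, w) then r v else 0) **
      adj (path_elt r u be w).
  move=> ck; rewrite /mono_elt /= -cmulA (cmulA (adj _) (path_elt _ _ al w)).
  by rewrite (path_elt_matrix_units ck v2 v3 l2 l3) cmulA.
rewrite !prod//; case: eqP => [[_ vw]|_]; last first.
  by right; rewrite !cmul0r !cmul0l.
left; exists (mu, be, v); subst w; split; first by rewrite /unit_in /= Jmu.
- by rewrite (path_elt_src cks).
- by rewrite (path_elt_src ckt).
Qed.

(** The constant of [nrm_units_bound] does not change when powers are taken. *)
Lemma nrm_units_le a b : span p s q t unit_in a b -> nrm b <= nrm a.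
Proof.
move: a b; apply: (@nrm_le_of_linear_growth _ _ _
  (fun _ a b => span p s q t unit_in a b) (size units)%:R _ _ _ _ 0%N) => //.
- by move=> _ _ a a' b b'; apply: spanM; apply: unitsM.
- by move=> _ a b; apply: span_adj => -[[mu nu] v]; rewrite /unit_in /= andbC.
- move=> n a b /nrm_units_bound /le_trans; apply.
  rewrite ler_wpM2r ?nrm_ge0// -natrM ler_nat mulnS; lia.
Qed.

End MatrixUnits.

Lemma span_level_finite N a b : span p s q t (level_mono N) a b ->
  exists2 J : seq (seq Ed * V),
    (forall i, i \in J -> valid ins i.1 i.2 /\ full_level N i.1 i.2)
    & span p s q t (unit_in J) a b.
Proof.
elim=> [|c m a' b' [/andP[v1 v2] l1 l2] _ [J JP sJ]].
  by exists [::] => //; apply: span0.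
exists ((m.1.1, m.2) :: (m.1.2, m.2) :: J).
  by move=> i; rewrite !inE => /orP[/eqP ->|/orP[/eqP ->|/JP]].
apply: spanS; first by rewrite /unit_in !inE !eqxx !orbT.
apply: span_mono sJ => m' /andP[h1 h2].
by rewrite /unit_in !inE h1 h2 !orbT.
Qed.

Definition balanced N (m : mono E) :=
  [/\ vmono ins m, size m.1.1 = size m.1.2 & (size m.1.1 <= N)%N].

Lemma nrm_balanced_le N a b : span p s q t (balanced N) a b -> nrm b <= nrm a.
Proof.
move=> sab; suff /span_level_finite[J JP] : span p s q t (level_mono N) a b.
  exact: nrm_units_le JP _ _.
elim: sab => [|c m a' b' [vm mm mN] _ IH]; first exact: span0.
by apply: spanD => //; apply: spanZ; apply: span_expand.
Qed.

End Core.

(** * Averaging over the gauge action *)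
Section RootsOfUnity.
Context {R : realType}.

Lemma prim_root_exists n : (0 < n)%N -> exists w : R[i], n.-primitive_root w.
Proof.
pose P : {poly R[i]} := 'X^n - 1; have [r Dp] := closed_field_poly_normal P.
move=> n_gt0; rewrite (monicP _) ?monicXnsubC // scale1r in Dp.
have rn1 : all n.-unity_root r by apply/allP=> z; rewrite -root_prod_XsubC -Dp.
have sz_r : (n < (size r).+1)%N.
  by rewrite -(size_prod_XsubC r id) -Dp size_XnsubC.
have [|z] := hasP (has_prim_root n_gt0 rn1 _ sz_r); last by exists z.
by rewrite -separable_prod_XsubC -Dp separable_Xn_sub_1 // pnatr_eq0 -lt0n.
Qed.

Lemma prim_root_sum n (w : R[i]) d k : n.-primitive_root w ->
  (d < n)%N -> (k < n)%N ->
  \sum_(t < n) (w ^+ d * w^-1 ^+ k) ^+ t = if d == k then n%:R else 0.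
Proof.
move=> pw dn kn; have n0 := prim_order_gt0 pw.
have w0 : w != 0 by rewrite (prim_root_eq0 pw) -lt0n.
set x := w ^+ d * w^-1 ^+ k.
have xn : x ^+ n = 1.
  by rewrite /x exprMn -!exprM mulnC (mulnC k) !exprM exprVn (prim_expr_order pw)
     invr1 !expr1n mulr1.
case: eqP => [dk|dk].
  have -> : x = 1 by rewrite /x dk exprVn mulfV// expf_neq0.
  under eq_bigr do rewrite expr1n.
  by rewrite sumr_const card_ord.
have x1 : x - 1 != 0.
  rewrite subr_eq0; apply/eqP => x1; apply: dk.
  have /eqP : w ^+ d = w ^+ k.
    by rewrite -[RHS]mul1r -x1 /x exprVn mulfVK// expf_neq0.
  by rewrite (eq_prim_root_expr pw) !modn_small// => /eqP.
by apply: (mulfI x1); rewrite -subrX1 xn subrr mulr0.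
Qed.

Lemma prim_root_norm n (w : R[i]) : n.-primitive_root w -> `|w| = 1.
Proof.
move=> pw; have n0 := prim_order_gt0 pw.
apply/eqP; rewrite -(@pexpr_eq1 _ _ n)//.
by rewrite -normrX (prim_expr_order pw) normr1.
Qed.

End RootsOfUnity.

Section Gauge.
Context {R : realType} (E : digraph) (ins : vertex E -> seq (edge E)).
Local Notation V := (vertex E).
Local Notation Ed := (edge E).
Hypothesis ins_rng : forall v e, e \in ins v -> rng e = v.
Context {A B : cstarAlgType R} (p : V -> A) (s : Ed -> A) (q : V -> B) (t : Ed -> B).
Hypotheses (cks : ck_relations ins p s) (ckt : ck_relations ins q t).
Hypothesis p_neq0 : forall v, p v <> 0.
Hypothesis gauge : forall z : R[i], `|z| = 1 -> exists g : A -> A,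
  [/\ star_hom g, forall v, g (p v) = p v
    & forall e, e \in ins (rng e) -> g (s e) = z *: s e].

Definition bounded N (m : mono E) :=
  [/\ vmono ins m, (size m.1.1 <= N)%N & (size m.1.2 <= N)%N].

Definition has_degree N k (m : mono E) :=
  bounded N m /\ (size m.1.1 + N = size m.1.2 + k)%N.

Lemma gauge_mono_elt (g : A -> A) (z : R[i]) : star_hom g ->
  (forall v, g (p v) = p v) ->
  (forall e, e \in ins (rng e) -> g (s e) = z *: s e) ->
  forall m, vmono ins m ->
  g (mono_elt p s m) = (z ^+ size m.1.1 * z^*%R ^+ size m.1.2) *: mono_elt p s m.
Proof.
move=> [_ gM gJ] gp gs.
have gpath mu v : valid ins mu v ->
    g (path_elt p s mu v) = z ^+ size mu *: path_elt p s mu v.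
  elim: mu => [|e mu IH] /=; first by rewrite gp scale1r.
  by case/and3P=> ei _ vmu; rewrite gM// gs// IH// cmulZl cmulZr scalerA exprS.
move=> [[mu nu] v] /andP[/= v1 v2]; rewrite /mono_elt /= gM// gJ// !gpath//.
by rewrite Defs.adjZ cmulZl cmulZr scalerA rmorphXn.
Qed.

(** The homogeneous components of [a] are discrete Fourier coefficients of its
    gauge orbit, and averages of contractions of [a] are no larger than [a].
    Degrees lie between [-N] and [N]; shifted by [N] they are distinguished by
    an [n]-th root of unity with [n = 2 N + 1].  The norm bound
    concerns [ak] only, because there is no gauge action on the second algebra. *)
Lemma homogeneous_components N a b : span p s q t (bounded N) a b ->
  exists (ak : nat -> A) (bk : nat -> B),
    [/\ b = \sum_(k < N.*2.+1) bk k,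
        forall k, (k < N.*2.+1)%N -> span p s q t (has_degree N k) (ak k) (bk k)
      & forall k, nrm (ak k) <= nrm a].
Proof.
set n := N.*2.+1; have [w pw] := @prim_root_exists R n isT.
have w1 := prim_root_norm pw.
have wJ : w^*%R = w^-1 by rewrite invC_norm w1 expr1n invr1 mul1r.
have w0 : w != 0 by rewrite (prim_root_eq0 pw).
have /choice[g gP] : forall j : nat, exists g : A -> A,
  [/\ star_hom g, forall v, g (p v) = p v
    & forall e, e \in ins (rng e) -> g (s e) = (w ^+ j) *: s e].
  by move=> j; apply: gauge; rewrite normrX w1 expr1n.
pose F k x : A := n%:R^-1 *:
  \sum_(j < n) (w ^+ j ^+ N * (w^-1) ^+ j ^+ k) *: g j x.
have gL j c x y : g j (c *: x + y) = c *: g j x + g j y.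
  by have [[gL _ _] _ _] := gP j; rewrite gL.
have g0 j : g j 0 = 0.
  by have := gL j (-1) 0 0; rewrite scaler0 addr0 scaleN1r addNr.
have FL k c x y : F k (c *: x + y) = c *: F k x + F k y.
  rewrite /F scalerA (mulrC c) -scalerA -scalerDr; congr (_ *: _).
  rewrite scaler_sumr -big_split /=; apply: eq_bigr => j _.
  by rewrite gL scalerDr !scalerA (mulrC c).
have n0 : (n%:R : R[i]) != 0 by rewrite pnatr_eq0.
have FT k m : (k < n)%N -> bounded N m -> F k (mono_elt p s m) =
    if (size m.1.1 + N == size m.1.2 + k)%N then mono_elt p s m else 0.
  move=> kn [vm s1 s2].
  (* [d] is the degree of [m], shifted by [N] to be a natural number. *)
  pose d := (size m.1.1 + (N - size m.1.2))%N.
  have dn : (d < n)%N by rewrite /d /n; lia.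
  have -> : (size m.1.1 + N == size m.1.2 + k)%N = (d == k).
    by rewrite /d; apply/eqP/eqP; lia.
  rewrite /F (eq_bigr (fun j : 'I_n => ((w ^+ d * w^-1 ^+ k) ^+ j) *: mono_elt p s m)).
    rewrite -scaler_suml (prim_root_sum pw dn kn).
    by case: eqP => _; rewrite ?scale0r ?scaler0// scalerA mulVf// scale1r.
  move=> j _; have [gh gp gs] := gP j; rewrite (gauge_mono_elt gh gp gs vm) scalerA.
  congr (_ *: _); rewrite rmorphXn /= wJ.
  set x := w ^+ j; set y := w^-1 ^+ j.
  have xy : x * y = 1 by rewrite /x /y exprVn mulfV// expf_neq0.
  have -> : (w ^+ d * w^-1 ^+ k) ^+ j = x ^+ d * y ^+ k.
    by rewrite exprMn /x /y -!exprM !(mulnC j).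
  have {1}-> : N = (size m.1.2 + (N - size m.1.2))%N by lia.
  have -> : x ^+ (size m.1.2 + (N - size m.1.2)) * y ^+ k *
     (x ^+ size m.1.1 * y ^+ size m.1.2) =
     (x * y) ^+ size m.1.2 * (x ^+ d * y ^+ k).
    by rewrite /d !exprD exprMn; ring.
  by rewrite xy expr1n mul1r.
have F0 k : F k 0 = 0.
  by rewrite /F big1 ?scaler0// => j _; rewrite g0 scaler0.
move=> sab; exists (fun k => F k a).
suff [bk [bE bS]] : exists bk : nat -> B, b = \sum_(k < n) bk k /\
    forall k, (k < n)%N -> span p s q t (has_degree N k) (F k a) (bk k).
  exists bk; split=> // k.
  have nw : cnorm w = 1 by apply: cnorm1.
  rewrite /F nrmZ.
  have -> : cnorm (n%:R^-1 : R[i]) = n%:R^-1.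
    have -> : (n%:R^-1 : R[i]) = (n%:R^-1)%:C by rewrite fmorphV rmorph_nat.
    by rewrite cnorm_real ?invr_ge0.
  rewrite mulrC ler_pdivrMr ?ltr0n// (le_trans (nrm_sum _ _ _))//.
  rewrite mulr_natr -[X in _ *+ X]card_ord -sumr_const ler_sum// => j _.
  have [gh _ _] := gP j; rewrite nrmZ cnorm1 ?mul1r ?star_hom_contractive//.
  by rewrite normrM !normrX normfV w1 invr1 !expr1n mulr1.
elim: sab => [|c m x y Pm _ [bk [bE bS]]].
  exists (fun=> 0); split; first by rewrite big1.
  by move=> k kn; rewrite F0; apply: span0.
have [vm s1 s2] := Pm.
pose d := (size m.1.1 + (N - size m.1.2))%N.
have dn : (d < n)%N by rewrite /d /n; lia.
exists (fun k => (if k == d then c *: mono_elt q t m else 0) + bk k); split.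
  rewrite big_split /= -bE; congr (_ + _).
  by rewrite -big_mkcond (big_pred1 (Ordinal dn)).
move=> k kn; rewrite FL FT//; apply: spanD; last exact: bS.
have -> : (size m.1.1 + N == size m.1.2 + k)%N = (k == d).
  by rewrite /d; apply/eqP/eqP; lia.
case: eqP => [kd|_]; last by rewrite scaler0; apply: span0.
apply: spanZ; apply: span_mono_elt; split=> //.
by rewrite kd /d; lia.
Qed.

(** For a homogeneous [y] the product of its adjoint with [y] lies in the core,
    where the comparison is known. *)
Lemma nrm_component_le N k x y : span p s q t (has_degree N k) x y -> nrm y <= nrm x.
Proof.
move=> sxy; rewrite -(@ler_pXn2r _ 2) ?nnegrE ?nrm_ge0// -!nrm_adjl.
apply: (nrm_balanced_le ins_rng cks ckt p_neq0 (N := (N + N)%N)).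
pose co m := bounded N m /\ (size m.1.2 + N = size m.1.1 + k)%N.
have sxy' : span p s q t co (adj x) (adj y).
  apply: span_adj sxy => -[[mu nu] v] [[]]; rewrite /vmono /= => /andP[v1 v2] s1 s2 d.
  by split=> //; split; rewrite /vmono //= v1 v2.
apply: spanM sxy' sxy => m1 m2 [[vm1 s1 s2] d1] [[vm2 s3 s4] d2].
case: (mono_eltM (R := R) vm1 vm2) => [[m [vm l1 l2 d h]]|h]; last first.
  by right; split; apply: h.
left; exists m; split; [|exact: h|exact: h].
by split=> //; lia.
Qed.

Lemma span_boundedM N M a a' b b' :
  span p s q t (bounded N) a b -> span p s q t (bounded M) a' b' ->
  span p s q t (bounded (N + M)) (a ** a') (b ** b').
Proof.
apply: spanM => m1 m2 [vm1 s1 s2] [vm2 s3 s4].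
case: (mono_eltM (R := R) vm1 vm2) => [[m [vm l1 l2 _ h]]|h]; last first.
  by right; split; apply: h.
left; exists m; split; [|exact: h|exact: h].
by split=> //; lia.
Qed.

Lemma span_boundedJ N a b :
  span p s q t (bounded N) a b -> span p s q t (bounded N) (adj a) (adj b).
Proof.
apply: span_adj => -[[mu nu] v] []; rewrite /bounded /vmono /=.
by move=> /andP[-> ->].
Qed.

(** The gauge-invariant uniqueness theorem, as a norm inequality.  An element of
    degree at most [N] has [2 N + 1] homogeneous components, each controlled by
    [nrm_component_le]; the resulting linear loss is removed by powers. *)
Theorem nrm_span_le N a b : span p s q t (bounded N) a b -> nrm b <= nrm a.
Proof.
move: N a b; apply: (@nrm_le_of_linear_growth _ _ _
  (fun N a b => span p s q t (bounded N) a b) 2%:R) => //.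
- exact: span_boundedM.
- exact: span_boundedJ.
- move=> N a b /homogeneous_components[ak [bk [-> bS ka]]].
  rewrite (le_trans (nrm_sum _ _ _))//.
  apply: (@le_trans _ _ (\sum_(k < N.*2.+1) nrm a)).
    apply: ler_sum => k _; apply: le_trans (ka k).
    by apply: nrm_component_le; apply: bS.
  rewrite sumr_const card_ord -[leLHS]mulr_natl ler_wpM2r ?nrm_ge0//.
  by rewrite -natrM ler_nat; lia.
Qed.

End Gauge.

(** * Extension to the closure *)
Section Extension.
Context {R : realType} {A B : cstarAlgType R} (G : A -> B -> Prop).
Hypothesis GL : forall (c : R[i]) a b a' b',
  G a b -> G a' b' -> G (c *: a + a') (c *: b + b').
Hypothesis GM : forall a b a' b', G a b -> G a' b' -> G (a ** a') (b ** b').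
Hypothesis GJ : forall a b, G a b -> G (adj a) (adj b).
Hypothesis G_le : forall a b, G a b -> nrm b <= nrm a.
Hypothesis G0 : G 0 0.
Hypothesis G_gen : forall D : set A, cstar_subalgebra D ->
  (forall a b, G a b -> D a) -> forall x, D x.

Definition graph_closure a b := forall e : R, 0 < e ->
  exists a' b', [/\ G a' b', nrm (a - a') < e & nrm (b - b') < e].

Local Notation H := graph_closure.

Lemma sub_graph_closure a b : G a b -> H a b.
Proof. by move=> Gab e e0; exists a, b; rewrite !subrr !nrm0. Qed.

Lemma graph_closureL (c : R[i]) a b a' b' :
  H a b -> H a' b' -> H (c *: a + a') (c *: b + b').
Proof.
move=> h h' e e0; have c0 : 0 <= cnorm c by rewrite -lecR -cnormE normr_ge0.
pose d := e / (cnorm c + 1); have c1 : 0 < cnorm c + 1 by rewrite ltr_wpDl.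
have d0 : 0 < d by rewrite divr_gt0.
have dE : (cnorm c + 1) * d = e by rewrite mulrC divfK ?gt_eqF.
have [x [y [Gxy ax bx]]] := h _ d0; have [x' [y' [Gxy' ax' bx']]] := h' _ d0.
exists (c *: x + x'), (c *: y + y'); split; first exact: GL.
  rewrite opprD addrACA -scalerBr (le_lt_trans (nrmD _ _))// nrmZ -dE.
  by rewrite mulrDl mul1r ler_ltD// ler_wpM2l// ltW.
rewrite opprD addrACA -scalerBr (le_lt_trans (nrmD _ _))// nrmZ -dE.
by rewrite mulrDl mul1r ler_ltD// ler_wpM2l// ltW.
Qed.

Lemma nrm_mul_dist (C : cstarAlgType R) (x x' y y' : C) (d : R) :
  nrm (x - y) < d -> nrm (x' - y') < d -> d <= 1 ->
  nrm (x ** x' - y ** y') <= (nrm x + nrm x' + 1) * d.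
Proof.
move=> h h' d1.
have -> : x ** x' - y ** y' = x ** (x' - y') + (x - y) ** y'.
  by rewrite cmulBr cmulBl subrKA.
have ny' : nrm y' <= nrm x' + 1.
  rewrite -[y'](subrK x') addrC (le_trans (nrmD _ _))// lerD2l nrm_distC.
  by rewrite (le_trans (ltW h')).
have := nrmD (x ** (x' - y')) ((x - y) ** y').
have := nrmM x (x' - y'); have := nrmM (x - y) y'.
have := nrm_ge0 x; have := nrm_ge0 x'; have := nrm_ge0 (x - y).
have := nrm_ge0 (x' - y'); have := nrm_ge0 y'.
move=> y0 xy0' xy0 x0' x0 m1 m2 m3.
have h1 : nrm x * nrm (x' - y') <= nrm x * d by rewrite ler_wpM2l// ltW.
have h2 : nrm (x - y) * nrm y' <= d * (nrm x' + 1).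
  by rewrite ler_pM// ltW.
lra.
Qed.

Lemma graph_closureM a b a' b' : H a b -> H a' b' -> H (a ** a') (b ** b').
Proof.
move=> h h' e e0.
pose K := nrm a + nrm a' + 1 + (nrm b + nrm b' + 1).
have K1 : 1 <= nrm a + nrm a' + 1 by rewrite lerDr addr_ge0 ?nrm_ge0.
have K2 : 1 <= nrm b + nrm b' + 1 by rewrite lerDr addr_ge0 ?nrm_ge0.
pose d := Num.min 1 (e / K).
have K0 : 0 < K by rewrite /K; lra.
have d0 : 0 < d by rewrite lt_min ltr01 divr_gt0.
have d1 : d <= 1 by rewrite ge_min lexx.
have dK : K * d <= e by rewrite mulrC -ler_pdivlMr// ge_min lexx orbT.
have [x [y [Gxy ax bx]]] := h _ d0; have [x' [y' [Gxy' ax' bx']]] := h' _ d0.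
exists (x ** x'), (y ** y'); split; first exact: GM.
  have := nrm_mul_dist ax ax' d1; move: dK; rewrite /K; nra.
have := nrm_mul_dist bx bx' d1; move: dK; rewrite /K; nra.
Qed.

Lemma graph_closureJ a b : H a b -> H (adj a) (adj b).
Proof.
move=> h e e0; have [x [y [Gxy ax bx]]] := h _ e0.
by exists (adj x), (adj y); rewrite -!adjB !nrm_adj; split=> //; apply: GJ.
Qed.

Lemma graph_closure_le a b : H a b -> nrm b <= nrm a.
Proof.
move=> h; apply/ler_addgt0Pl => e e0.
have [|x [y [Gxy ax bx]]] := h (e / 2%:R); first by rewrite divr_gt0.
have := G_le Gxy; have := nrmD (b - y) y; have := nrmD (x - a) a.
rewrite !subrK (nrm_distC x); lra.
Qed.

Lemma graph_closure_fun a b b' : H a b -> H a b' -> b = b'.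
Proof.
move=> h h'; have := graph_closure_le (graph_closureL (-1) h h').
rewrite !scaleN1r addNr nrm0 => le0; apply/esym/eqP; rewrite -subr_eq0 addrC.
by apply/eqP/nrm0_eq0/eqP; rewrite eq_le le0 nrm_ge0.
Qed.

(** Since [G] is contractive, a sequence in its domain converging to [x] has a
    Cauchy sequence of images. *)
Lemma graph_closure_complete x :
  (forall e : R, 0 < e -> exists a b, G a b /\ nrm (x - a) < e) ->
  exists b, H x b.
Proof.
move=> xG; pose h : R := 2%:R^-1.
have h01 : 0 <= h < 1 by rewrite invr_ge0 ler0n invf_lt1// ltr1n.
have h0 : 0 < h by rewrite invr_gt0.
have /choice[u uP] : forall n, exists ab : A * B,
    G ab.1 ab.2 /\ nrm (x - ab.1) < h ^+ n.
  move=> n; have [|a [b Gab]] := xG (h ^+ n); first by rewrite exprn_gt0.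
  by exists (a, b).
have d0 : forall e : R, 0 < e -> exists n, 2%:R * h ^+ n < e.
  move=> e e0; have [|n hn] := expr_to0 h01 (e := e / 2%:R); first by rewrite divr_gt0.
  by exists n; rewrite mulrC -ltr_pdivlMr.
have [|b bP] := @complete_nrm _ _ (fun n => (u n).2) (fun n => 2%:R * h ^+ n) _ d0.
  move=> n m nm; have [Gn an] := uP n; have [Gm am] := uP m.
  have := G_le (GL (-1) Gn Gm); rewrite !scaleN1r ![- _ + _]addrC => le.
  apply: le_trans le _; rewrite -(subrKA x) (le_trans (nrmD _ _))// mulr_natl mulr2n.
  rewrite lerD ?(ltW an)// nrm_distC (le_trans (ltW am))// ler_wiXn2l//.
    by rewrite ltW.
  by case/andP: h01 => _ /ltW.
exists b => e e0; have [n dn] := d0 _ e0; have [Gn an] := uP n.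
exists (u n).1, (u n).2; split=> //; last by rewrite nrm_distC (le_lt_trans (bP n)).
rewrite (lt_trans an)// (le_lt_trans _ dn)// ler_peMl ?ler1n//.
by rewrite exprn_ge0 ?ltW.
Qed.

Lemma graph_closure_total x : exists b, H x b.
Proof.
move: x; apply: (G_gen (D := [set x | exists b, H x b])).
  split.
  - by exists 0; apply: sub_graph_closure.
  - by move=> c x y [b hb] [b' hb']; exists (c *: b + b'); apply: graph_closureL.
  - by move=> x y [b hb] [b' hb']; exists (b ** b'); apply: graph_closureM.
  - by move=> x [b hb]; exists (adj b); apply: graph_closureJ.
  apply: closed_nrm => x xD; apply: graph_closure_complete => e e0.
  have [|y [b hb] xy] := xD (e / 2%:R); first by rewrite divr_gt0.
  have [|a' [b' [Gab ya _]]] := hb (e / 2%:R); first by rewrite divr_gt0.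
  exists a', b'; split=> //; rewrite -(subrKA y) (le_lt_trans (nrmD _ _))//.
  lra.
by move=> a b Gab; exists b; apply: sub_graph_closure.
Qed.

Lemma star_hom_extension : exists f : A -> B,
  star_hom f /\ forall a b, G a b -> f a = b.
Proof.
have /choice[f fP] := graph_closure_total.
exists f; split; last first.
  by move=> a b /sub_graph_closure; apply: graph_closure_fun.
split.
- by move=> c x y _ _; apply: graph_closure_fun (fP _) _; apply: graph_closureL.
- by move=> x y _ _; apply: graph_closure_fun (fP _) _; apply: graph_closureM.
- by move=> x _; apply: graph_closure_fun (fP _) _; apply: graph_closureJ.
Qed.

End Extension.

(** * Cycles without entrance and cutting sets *)
Section CyclesWithoutEntrance.
Variable E : digraph.
Local Notation Ed := (edge E).
Implicit Types (mu : seq Ed) (X : set Ed).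

Definition composable : rel Ed := fun e f => src e == rng f.

Lemma is_cycleE mu :
  is_cycle mu <-> [/\ mu != [::], cycle composable mu & uniq (map (@src E) mu)].
Proof.
case: mu => [|e mu] /=; first by split=> // -[].
rewrite /is_path /= rcons_path /composable; split.
  by case=> -> re ->; split=> //; rewrite re eqxx.
by case=> _ /andP[-> /eqP ->] ->.
Qed.

Lemma is_cycle_rot n mu : is_cycle mu -> is_cycle (rot n mu).
Proof.
move=> /is_cycleE[mu0 cmu umu]; apply/is_cycleE; split.
- by rewrite -size_eq0 size_rot size_eq0.
- by rewrite rot_cycle.
- by rewrite map_rot rot_uniq.
Qed.

Lemma no_entrance_rot n mu : no_entrance mu -> no_entrance (rot n mu).
Proof. by move=> h e f; rewrite mem_rot; apply: h. Qed.

Lemma mem_class_edges mu e : class_edges (cyclic_class mu) e <-> e \in mu.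
Proof.
split=> [[nu [n _ <-]]|emu]; first by rewrite mem_rot.
by exists mu => //; exists 0%N; rewrite ?rot0.
Qed.

(** An edge [f] that can be appended to [e] has the same range as the successor
    of [e] in the cycle, hence is that successor. *)
Lemma cycle_no_exit mu e f : is_cycle mu -> no_entrance mu ->
  e \in mu -> src e = rng f -> f \in mu.
Proof.
move=> /is_cycleE[_ cmu _] ne emu ef; have := next_cycle cmu emu.
rewrite /composable ef => /eqP rf; by rewrite (ne f (next mu e)) ?mem_next.
Qed.

Lemma cycle_no_exit_path mu e nu : is_cycle mu -> no_entrance mu ->
  e \in mu -> path composable e nu -> {subset nu <= mu}.
Proof.
move=> cmu nmu; elim: nu e => [|f nu IH] e emu //= /andP[/eqP ef pnu] g.
have fmu := cycle_no_exit cmu nmu emu ef.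
by rewrite inE => /orP[/eqP -> //|]; apply: IH fmu pnu g.
Qed.

Lemma cycles_sharing_edge mu nu e : is_cycle mu -> no_entrance mu ->
  is_cycle nu -> e \in mu -> e \in nu -> {subset nu <= mu}.
Proof.
move=> cmu nmu cnu emu enu f fnu; have [i nu' rnu] := rot_to enu.
have /is_cycleE[_ cnu' _] := is_cycle_rot i cnu.
move: fnu; rewrite -(mem_rot i) rnu inE => /orP[/eqP -> //|fnu'].
move: cnu'; rewrite rnu /= rcons_path => /andP[pnu' _].
exact: cycle_no_exit_path cmu nmu emu pnu' _ fnu'.
Qed.

(** Cycles without entrance that meet have the same edges, so choosing the edge
    with the least code in each cycle is unambiguous. *)
Lemma cutting_set_exists : exists X : set Ed, cutting_set X.
Proof.
pose least mu e := e \in mu /\ forall f, f \in mu -> (pickle e <= pickle f)%N.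
exists [set e | exists mu, [/\ is_cycle mu, no_entrance mu & least mu e]].
split=> [e [mu [cmu nmu [emu _]]]|C [mu [cmu nmu] <-]].
  by exists (cyclic_class mu); [exists mu|apply/mem_class_edges].
have [x [xmu xmin]] : exists x, least mu x.
  have ex : exists n, n \in map pickle mu.
    case: mu cmu {nmu} => // e mu _; exists (pickle e).
    by rewrite /= inE eqxx.
  have [n /mapP[x xmu xE] mn] := ex_minnP ex.
  by exists x; split=> // f fmu; rewrite -xE mn// map_f.
exists x; apply/seteqP; split=> [e [[nu [cnu nnu [enu emin]]]]|e ->].
  move=> /mem_class_edges emu; apply: (pcan_inj (@pickleK _)).
  apply/eqP; rewrite eqn_leq emin ?xmin//.
  exact: cycles_sharing_edge cnu nnu cmu enu emu _ xmu.
split; last exact/mem_class_edges.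
by exists mu.
Qed.

Lemma cutting_set_cycle X x : cutting_set X -> X x ->
  exists mu, [/\ is_cycle (x :: mu), no_entrance (x :: mu)
    & forall f, f \in mu -> ~ X f].
Proof.
move=> [Xsub Xone] Xx; have [C [mu [cmu nmu] CE] xC] := Xsub _ Xx.
have [y XC] := Xone C (ex_intro2 _ _ mu (conj cmu nmu) CE).
move: xC; rewrite -CE => /mem_class_edges xmu.
have [i mu' rmu] := rot_to xmu; exists mu'; rewrite -rmu.
have cmu' := is_cycle_rot i cmu; split=> //; first exact: no_entrance_rot.
move=> f fmu' Xf.
have inC g : g \in mu -> X g -> g = y.
  move=> gmu Xg; have : (X `&` class_edges C) g.
    by split=> //; rewrite -CE; apply/mem_class_edges.
  by rewrite XC => ->.
have fmu : f \in mu by rewrite -(mem_rot i) rmu inE fmu' orbT.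
have fx : f = x by rewrite (inC f fmu Xf) (inC x xmu Xx).
move: cmu'; rewrite rmu => -[_ _] /map_uniq /=.
by rewrite -fx fmu'.
Qed.

End CyclesWithoutEntrance.

(** * Families over the graph with a cutting set deleted *)
Section ActiveEdges.
Context {R : realType} (E : digraph) (E_row_finite : row_finite E) (X : set (edge E)).
Local Notation V := (vertex E).
Local Notation Ed := (edge E).

Definition in_edges (v : V) : seq Ed := finmap.enum_fset (fset_set (edges_into v)).

Lemma mem_in_edges v e : (e \in in_edges v) = (rng e == v).
Proof.
rewrite /in_edges in_fset_set; last exact: E_row_finite.
by apply/idP/eqP => [/set_mem|re]; last apply/mem_set.
Qed.

(** An edge of a cutting set is the only edge into its range, so deleting it
    leaves a vertex without incoming edges. *)
Definition uncut_edges (v : V) : seq Ed :=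
  if `[< exists2 x, X x & rng x = v >] then [::] else in_edges v.

Lemma uncut_edges_rng v e : e \in uncut_edges v -> rng e = v.
Proof. by rewrite /uncut_edges; case: asboolP => // _; rewrite mem_in_edges => /eqP. Qed.

Lemma uncut_edges_not_cut e : e \in uncut_edges (rng e) -> ~ X e.
Proof. by rewrite /uncut_edges; case: asboolP => // nX _ Xe; apply: nX; exists e. Qed.

Hypothesis X_cut : cutting_set X.

Lemma not_cut_uncut_edges e : ~ X e -> e \in uncut_edges (rng e).
Proof.
move=> nXe; rewrite /uncut_edges; case: asboolP; last by rewrite mem_in_edges.
move=> [x Xx re]; case: nXe; have [mu [_ ne _]] := cutting_set_cycle X_cut Xx.
by rewrite (ne e x) ?inE ?eqxx.
Qed.

(** The range projections of the edges into [v] add up to the projection [p v],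
    and [projection_sum] yields their orthogonality and [p v] as a left unit. *)
Lemma CK_family_relations (A : cstarAlgType R) (p : V -> A) (s : Ed -> A) :
  CK_family p s -> ck_relations uncut_edges p s.
Proof.
move=> [[pP pO sS _] CK].
have sp e : s e ** p (src e) = s e by apply: partial_isometry_src.
have ss e : s e ** adj (s e) ** s e = s e by rewrite -cmulA sS.
have sum v : in_edges v != [::] ->
    p v = \sum_(e <- in_edges v) (s e ** adj (s e)).
  move=> v0; rewrite CK; last exact: E_row_finite.
    by rewrite fsbig_finite//; apply: E_row_finite.
  case ev : (in_edges v) v0 => [//|e l] _; exists e.
  by apply/eqP; rewrite -mem_in_edges ev inE eqxx.
have range_proj e : projection (s e ** adj (s e)).
  by split; rewrite ?adjM ?adjK// cmulA ss.
have local e : p (rng e) ** (s e ** adj (s e)) = s e ** adj (s e) /\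
    forall f, f \in in_edges (rng e) -> f != e ->
      s f ** adj (s f) ** (s e ** adj (s e)) = 0.
  have ei : e \in in_edges (rng e) by rewrite mem_in_edges.
  apply: (projection_sum (s := in_edges (rng e))) => //.
  - exact: finmap.fset_uniq.
  - by apply: sum; case: (in_edges _) ei.
have ps e : p (rng e) ** s e = s e.
  by rewrite -{1}ss cmulA (local e).1 ss.
split=> //.
- move=> e f ef; have [re|/eqP re] := eqVneq (rng e) (rng f); last first.
    rewrite -ps -[s f]ps adjM; have [-> _] := pP (rng e).
    by rewrite -cmulA (cmulA (p _)) pO// cmul0l cmul0r.
  have ei : e \in in_edges (rng f) by rewrite mem_in_edges re.
  have /(_ (introN eqP ef)) := (local f).2 _ ei.
  move=> /(congr1 (fun x => adj (s e) ** x ** s f)); rewrite cmul0r cmul0l.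
  by rewrite !cmulA sS -(cmulA _ (adj (s f)) (s f)) sS -cmulA sp -{2}(sp e) adjM;
    have [-> _] := pP (src e).
- move=> v; rewrite /uncut_edges; case: asboolP => // _; exact: sum.
Qed.

Lemma valid_of_path e mu v : path (@composable E) e mu -> src (last e mu) = v ->
  (forall f, f \in mu -> f \in uncut_edges (rng f)) ->
  valid uncut_edges mu v /\ src e = path_range mu v.
Proof.
elim: mu e => [|f mu IH] e //= /andP[/eqP ef pmu] lv act.
have [|vmu sf] := IH f pmu lv; first by move=> g gmu; apply: act; rewrite inE gmu orbT.
by rewrite act ?inE ?eqxx// sf eqxx.
Qed.

Lemma foldl_path_elt (A : cstarAlgType R) (p : V -> A) (s : Ed -> A) y mu v :
  foldl (fun x f => x ** s f) y mu ** p v = y ** path_elt p s mu v.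
Proof. by elim: mu y => [|f mu IH] y //=; rewrite IH cmulA. Qed.

(** A deleted edge is recovered from the rest of its cycle: the normalisation
    says that [s x] times the remaining path is a vertex projection, so the
    remaining path is the adjoint of [s x]. *)
Lemma cut_edge_elt (A : cstarAlgType R) (p : V -> A) (s : Ed -> A) x mu :
  normalised_reduced_CK_family p s -> is_cycle (x :: mu) -> no_entrance (x :: mu) ->
  src x = path_range mu (rng x) -> s x = adj (path_elt p s mu (rng x)).
Proof.
move=> [ck norm] cmu nmu sx; have rel := CK_family_relations ck.
have := foldl_path_elt p s (s x) mu (rng x).
have -> : foldl (fun x f => x ** s f) (s x) mu = p (rng x) by apply: norm.
rewrite (ck_idem rel) => /(congr1 (fun y => adj (s x) ** y)).
rewrite cmulA (ck_src rel) sx (range_path_elt rel) => <-.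
by rewrite adjM adjK (ck_adj_proj rel) (ck_rng rel).
Qed.

Section Generators.
Context {A B : cstarAlgType R} (p : V -> A) (s : Ed -> A) (q : V -> B) (t : Ed -> B).
Hypotheses (nps : normalised_reduced_CK_family p s)
  (nqt : normalised_reduced_CK_family q t).

Definition joint_span a b := exists N, span p s q t (bounded uncut_edges N) a b.

Lemma joint_span_mono m : vmono uncut_edges m ->
  joint_span (mono_elt p s m) (mono_elt q t m).
Proof.
move=> vm; exists (size m.1.1 + size m.1.2)%N; apply: span_mono_elt.
by split=> //; lia.
Qed.

Lemma joint_span_vertex v : joint_span (p v) (q v).
Proof.
have cp := CK_family_relations nps.1; have cq := CK_family_relations nqt.1.
have := @joint_span_mono ([::], [::], v) isT; rewrite /mono_elt /=.
by rewrite !(ck_adj_proj cp, ck_adj_proj cq, ck_idem cp, ck_idem cq).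
Qed.

Lemma joint_span_edge e : joint_span (s e) (t e).
Proof.
have cp := CK_family_relations nps.1; have cq := CK_family_relations nqt.1.
have [Xe|nXe] := pselect (X e); last first.
  have := @joint_span_mono ([:: e], [::], src e).
  rewrite /mono_elt /vmono /= (ck_adj_proj cp) (ck_adj_proj cq) -!cmulA.
  rewrite (ck_idem cp) (ck_idem cq) (ck_srcr cp) (ck_srcr cq).
  by rewrite not_cut_uncut_edges// eqxx; apply.
have [mu [cmu nmu muX]] := cutting_set_cycle X_cut Xe.
have [|||vmu se] := @valid_of_path e mu (rng e).
- by have [] := cmu.
- by have [] := cmu.
- by move=> f /muX; apply: not_cut_uncut_edges.
rewrite (cut_edge_elt nps cmu nmu se) (cut_edge_elt nqt cmu nmu se).
have := @joint_span_mono ([::], mu, rng e); rewrite /vmono /= vmu => /(_ isT).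
rewrite /mono_elt /= -{1}(ck_adj_proj cp) -{1}(ck_adj_proj cq) -!adjM.
by rewrite (path_elt_src cp) (path_elt_src cq).
Qed.

End Generators.

End ActiveEdges.

(** * The gauge action from co-universality *)
Section Couniversal.
Context {R : realType} (E : digraph).
Local Notation V := (vertex E).
Local Notation Ed := (edge E).

Lemma family_algebra_rotate (A : cstarAlgType R) (p : V -> A) (s : Ed -> A) (z : R[i]) :
  z != 0 -> family_algebra p s = setT ->
  family_algebra p (fun e => z *: s e) = setT.
Proof.
move=> z0 psT; apply/seteqP; split=> // x _ D [DA DS].
have : family_algebra p s x by rewrite psT.
apply; split=> //; case: (DA) => D0 DL _ _ _ y [[v _ <-]|[e _ <-]].
  by apply: DS; left; exists v.
rewrite -[s e](scalerK z0) -[_ *: (z *: _)]addr0; apply: DL => //.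
by apply: DS; right; exists e.
Qed.

Lemma toeplitz_rotate (A : cstarAlgType R) (p : V -> A) (s : Ed -> A) (z : R[i]) :
  `|z| = 1 -> toeplitz_CK_family p s -> toeplitz_CK_family p (fun e => z *: s e).
Proof.
move=> z1 [pP pO sS sum].
have zz : z * z^*%R = 1 by rewrite -normCK z1 expr1n.
split=> //.
  by move=> e; rewrite Defs.adjZ cmulZl cmulZr scalerA mulrC zz scale1r.
move=> v F fF Fv; have := sum v F fF Fv.
rewrite (_ : \sum_(e \in F) (z *: s e ** adj (z *: s e)) =
             \sum_(e \in F) (s e ** adj (s e))) //.
apply: eq_fsbigr => e _.
by rewrite Defs.adjZ cmulZl cmulZr scalerA zz scale1r.
Qed.

(** Rotating the canonical family by the inverse of [z] gives a Toeplitz family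
    with nonzero vertex projections that still generates the whole algebra.  The
    map supplied by co-universality undoes this rotation off [X]. *)
Lemma couniversal_gauge (A : cstarAlgType R) (p : V -> A) (s : Ed -> A) (X : set Ed) :
  is_cstar_min p s -> cutting_set X -> forall z : R[i], `|z| = 1 ->
  exists g : A -> A, [/\ star_hom g, forall v, g (p v) = p v
    & forall e, ~ X e -> g (s e) = z *: s e].
Proof.
move=> [[[tck _] _] psT p0 univ] Xcut z z1.
have z0 : z != 0 by rewrite -normr_eq0 z1 oner_eq0.
have zV1 : `|z^-1| = 1 by rewrite normfV z1 invr1.
have [_ [g [_ gh gp gs _]]] := univ A p (fun e => z^-1 *: s e)
  (toeplitz_rotate zV1 tck) p0 X Xcut.
rewrite family_algebra_rotate ?invr_eq0// in gh.
exists g; split=> // e nXe; have [gL _ _] := gh.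
have g0 : g 0 = 0.
  by have := gL (-1) 0 0 I I; rewrite scaler0 addr0 scaleN1r addNr.
by rewrite -{2}(gs e nXe) -[_ *: s e]addr0 gL// g0 addr0 scalerA mulfV// scale1r.
Qed.

End Couniversal.

Theorem corollary4p5 (R : realType) (E : digraph) (E_row_finite : row_finite E)
    (Cmin : cstarAlgType R) (pm : vertex E -> Cmin) (sm : edge E -> Cmin)
    (Cmin_couniversal : is_cstar_min pm sm)
    (B : cstarAlgType R) (q : vertex E -> B) (t : edge E -> B)
    (qt_family : normalised_reduced_CK_family q t) :
  exists pi : Cmin -> B,
    [/\ star_hom pi,
        (forall v : vertex E, pi (pm v) = q v)
      & (forall e : edge E, pi (sm e) = t e)].
Proof.
have [X Xcut] := cutting_set_exists E.
have [nps psT p0 _] := Cmin_couniversal.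
pose ins := uncut_edges X.
have cp : ck_relations ins pm sm := CK_family_relations E_row_finite X nps.1.
have cq : ck_relations ins q t := CK_family_relations E_row_finite X qt_family.1.
have ins_rng v e : e \in ins v -> rng e = v by apply: uncut_edges_rng.
have gauge z : `|z| = 1 -> exists g : Cmin -> Cmin,
    [/\ star_hom g, forall v, g (pm v) = pm v
      & forall e, e \in ins (rng e) -> g (sm e) = z *: sm e].
  move=> /(couniversal_gauge Cmin_couniversal Xcut)[g [gh gp gs]].
  by exists g; split=> // e /uncut_edges_not_cut; apply: gs.
pose G := joint_span X pm sm q t.
have Gv v : G (pm v) (q v) by apply: joint_span_vertex.
have Ge e : G (sm e) (t e) by apply: joint_span_edge.
have [||||||pi [pih piG]] := @star_hom_extension _ _ _ G.
- move=> c a b a' b' [N sab] [M sab']; exists (maxn N M).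
  apply: spanD; first apply: spanZ.
    by apply: span_mono sab => m [vm s1 s2]; split=> //; lia.
  by apply: span_mono sab' => m [vm s1 s2]; split=> //; lia.
- move=> a b a' b' [N sab] [M sab']; exists (N + M)%N.
  exact: (span_boundedM cp cq sab sab').
- move=> a b [N sab]; exists N; exact: span_boundedJ.
- move=> a b [N]; exact: (nrm_span_le ins_rng cp cq p0 gauge).
- by exists 0%N; apply: span0.
- move=> D Dalg DG x; have : family_algebra pm sm x by rewrite psT.
  apply; split=> //; move=> y [[v _ <-]|[e _ <-]]; first exact: DG (Gv v).
  exact: DG (Ge e).
by exists pi; split=> // [v|e]; apply: piG.
Qed.
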